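(* Let $n\ge 3$ and let $F$ be an infinite field of characteristic $\neq 2$. If $H$ is any group with $H\equiv \mathrm{T}_n(F)$, then $H\cong \mathrm{T}_n(L,f,Z)$ for some field $L\equiv F$, some symmetric 2-cocycle $f\in S^2(B_n(L),Z)$ and an abelian group $Z=Z(H)\equiv Z(\mathrm{T}_n(F))\cong F^\times$.
   Context: $\equiv$ denotes elementary equivalence (language of groups for groups, language of rings for fields); $Z(G)$ is the center of $G$; $F^\times$ is the multiplicative group of $F$. $\mathrm{T}_n(L)$ is the group of invertible upper triangular $n\times n$ matrices over $L$, $\mathrm{UT}_n(L)$ its subgroup of unitriangular matrices, $D_n(L)$ the group of invertible diagonal matrices. For $\alpha\in L^\times$ let $d_i(\alpha)$ be the diagonal matrix with $\alpha$ in position $i$ and $1$ elsewhere on the diagonal, and put $B_n(L)=\prod_{i=1}^{n-1}d_i(L^\times)\cong (L^\times)^{n-1}$; thus $D_n(L)=B_n(L)\times Z(\mathrm{T}_n(L))$. For abelian groups $B,Z$, $S^2(B,Z)$ is the group of symmetric 2-cocycles: functions $f:B\times B\to Z$ with $f(xy,z)f(x,y)=f(x,yz)f(y,z)$, $f(1,x)=f(x,1)=1$ and $f(x,y)=f(y,x)$. For $f\in S^2(B_n(L),Z)$, $Z$ an abelian group, $D_n(L,f,Z)$ is the abelian group with underlying set $Z\times B_n(L)$ and product $(z_1,b_1)(z_2,b_2)=(z_1z_2f(b_1,b_2),b_1b_2)$, an abelian extension of $Z$ by $B_n(L)$. The abelian deformation $\mathrm{T}_n(L,f,Z)=\mathrm{UT}_n(L)\rtimes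 D_n(L,f,Z)$ is the group with product $$(u_1,(z_1,b_1))(u_2,(z_2,b_2))=(u_1\cdot b_1u_2b_1^{-1},\ (z_1z_2f(b_1,b_2),b_1b_2)),$$ i.e. $Z$ acts trivially on $\mathrm{UT}_n(L)$ and $B_n(L)$ acts by conjugation. *)

(* Defs.v *)
From HB Require Import structures.
From mathcomp Require Import all_boot all_algebra.
From mathcomp Require Import boolp classical_sets cardinality.
Set Implicit Arguments.
Unset Strict Implicit.
Unset Printing Implicit Defensive.

Import GRing.Theory.
Local Open Scope ring_scope.

(* Formulas over a type T of terms whose variables are indexed by nat; the
   atomic formulas are equations, as the languages of groups and of rings have
   no relation symbol. *)
Inductive formula (T : Type) : Type :=
| FFalse
| FEq of T & T
| FAnd of formula T & formula T
| FOr of formula T & formula T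
| FImp of formula T & formula T
| FForall of nat & formula T
| FExists of nat & formula T.

Fixpoint free_vars (T : Type) (tvars : T -> seq nat) (phi : formula T) :
    seq nat :=
  match phi with
  | FFalse => [::]
  | FEq t u => tvars t ++ tvars u
  | FAnd p q | FOr p q | FImp p q => free_vars tvars p ++ free_vars tvars q
  | FForall i p | FExists i p => [seq j <- free_vars tvars p | j != i]
  end.

Definition upd (M : Type) (e : nat -> M) (i : nat) (x : M) : nat -> M :=
  fun j => if j == i then x else e j.

Fixpoint sat (T M : Type) (ev : (nat -> M) -> T -> M) (e : nat -> M)
    (phi : formula T) : Prop :=
  match phi with
  | FFalse => False
  | FEq t u => ev e t = ev e u
  | FAnd p q => sat ev e p /\ sat ev e q
  | FOr p q => sat ev e p \/ sat ev e q
  | FImp p q => sat ev e p -> sat ev e q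
  | FForall i p => forall x, sat ev (upd e i x) p
  | FExists i p => exists x, sat ev (upd e i x) p
  end.

(* The truth value of a sentence does not depend on the valuation, so the
   quantification over valuations is harmless for nonempty M and N. *)
Definition elem_equiv (T : Type) (tvars : T -> seq nat) (M N : Type)
    (evM : (nat -> M) -> T -> M) (evN : (nat -> N) -> T -> N) : Prop :=
  forall phi : formula T, free_vars tvars phi = [::] ->
  forall (eM : nat -> M) (eN : nat -> N), sat evM eM phi <-> sat evN eN phi.

Inductive gterm : Type :=
| GVar of nat
| GOne
| GMul of gterm & gterm
| GInv of gterm.

Fixpoint gvars (t : gterm) : seq nat :=
  match t with
  | GVar i => [:: i]
  | GOne => [::]
  | GMul t u => gvars t ++ gvars u
  | GInv t => gvars t
  end.

Fixpoint geval (G : groupType) (e : nat -> G) (t : gterm) : G :=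
  match t with
  | GVar i => e i
  | GOne => 1%g
  | GMul t u => (geval e t * geval e u)%g
  | GInv t => ((geval e t)^-1)%g
  end.

Definition group_equiv (G K : groupType) : Prop :=
  elem_equiv gvars (@geval G) (@geval K).

Inductive rterm : Type :=
| RVar of nat
| RZero
| ROne
| RAdd of rterm & rterm
| ROpp of rterm
| RMul of rterm & rterm.

Fixpoint rvars (t : rterm) : seq nat :=
  match t with
  | RVar i => [:: i]
  | RZero | ROne => [::]
  | RAdd t u | RMul t u => rvars t ++ rvars u
  | ROpp t => rvars t
  end.

Fixpoint reval (R : nzRingType) (e : nat -> R) (t : rterm) : R :=
  match t with
  | RVar i => e i
  | RZero => 0
  | ROne => 1
  | RAdd t u => reval e t + reval e u
  | ROpp t => - reval e t
  | RMul t u => reval e t * reval e u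
  end.

Definition field_equiv (K L : fieldType) : Prop :=
  elem_equiv rvars (@reval K) (@reval L).

Definition group_iso (G K : groupType) : Prop :=
  exists phi : {multiplicative G -> K}, bijective phi.

HB.mixin Record Group_isAbelian G of Group G := {
  abmulgC : commutative (@monoid.mul G)
}.
#[short(type="abGroupType")]
HB.structure Definition AbGroup := {G of Group G & Group_isAbelian G}.

Section Center.
Variable G : groupType.

Definition centerg : {pred G} := fun z => `[< forall g : G, z * g = g * z >]%g.

Lemma centergP z :
  reflect (forall g : G, z * g = g * z)%g (z \in centerg).
Proof. exact: asboolP. Qed.

Lemma centerg_closed : group_closed centerg.
Proof.
split; first by apply/centergP => g; rewrite mul1g mulg1.
move=> x y /centergP cx /centergP cy; apply/centergP => g.
have cyV : (y^-1 * g = g * y^-1)%g.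
  by apply: (@mulgI _ y); rewrite mulVKg mulgA cy mulgK.
by rewrite -mulgA cyV mulgA cx mulgA.
Qed.

Definition center := {z : G | z \in centerg}.
HB.instance Definition _ := SubChoice.on center.
HB.instance Definition _ :=
  SubChoice_isSubGroup.Build G centerg center centerg_closed.

Lemma center_mulC : commutative (@monoid.mul center).
Proof.
move=> x y; apply: val_inj; rewrite !valM.
by have /centergP -> := valP x.
Qed.
HB.instance Definition _ := Group_isAbelian.Build center center_mulC.

End Center.

Section Units.
Variable F : fieldType.

Definition units := {x : F | x != 0}.
HB.instance Definition _ := SubChoice.on units.

Definition units_one : units := exist (fun x : F => x != 0) 1 (oner_neq0 F).
Fact units_mul_subproof (x y : units) : val x * val y != 0.
Proof. by rewrite mulf_neq0 ?(valP x) ?(valP y). Qed.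
Definition units_mul (x y : units) : units := exist (fun x : F => x != 0) _ (units_mul_subproof x y).
Fact units_inv_subproof (x : units) : (val x)^-1 != 0.
Proof. by rewrite invr_neq0 ?(valP x). Qed.
Definition units_inv (x : units) : units := exist (fun x : F => x != 0) _ (units_inv_subproof x).

Fact units_mulA : associative units_mul.
Proof. by move=> x y z; apply: val_inj; rewrite /= mulrA. Qed.
Fact units_mul1 : left_id units_one units_mul.
Proof. by move=> x; apply: val_inj; rewrite /= mul1r. Qed.
Fact units_mulr1 : right_id units_one units_mul.
Proof. by move=> x; apply: val_inj; rewrite /= mulr1. Qed.
Fact units_mulV : left_inverse units_one units_inv units_mul.
Proof. by move=> x; apply: val_inj; rewrite /= mulVf ?(valP x). Qed.
Fact units_mulrV : right_inverse units_one units_inv units_mul.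
Proof. by move=> x; apply: val_inj; rewrite /= divff ?(valP x). Qed.

HB.instance Definition _ := isGroup.Build units
  units_mulA units_mul1 units_mulr1 units_mulV units_mulrV.

Fact units_mulC : commutative (@monoid.mul units).
Proof. by move=> x y; apply: val_inj; rewrite /= mulrC. Qed.
HB.instance Definition _ := Group_isAbelian.Build units units_mulC.

End Units.

Section MatrixGroups.
Variables (F : fieldType) (n : nat).

(* The library's 'GL_n[F] requires F to be finite. *)
Definition GLn := {A : 'M[F]_n | A \in unitmx}.
HB.instance Definition _ := SubChoice.on GLn.

Definition GLn_one : GLn := exist (fun A : 'M[F]_n => A \in unitmx) 1%:M (unitmx1 F n).
Fact GLn_mul_subproof (A B : GLn) : val A *m val B \in unitmx.
Proof. by rewrite unitmx_mul (valP A) (valP B). Qed.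
Definition GLn_mul (A B : GLn) : GLn :=
  exist (fun A : 'M[F]_n => A \in unitmx) _ (GLn_mul_subproof A B).
Fact GLn_inv_subproof (A : GLn) : invmx (val A) \in unitmx.
Proof. by rewrite unitmx_inv (valP A). Qed.
Definition GLn_inv (A : GLn) : GLn :=
  exist (fun A : 'M[F]_n => A \in unitmx) _ (GLn_inv_subproof A).

Fact GLn_mulA : associative GLn_mul.
Proof. by move=> x y z; apply: val_inj; rewrite /= mulmxA. Qed.
Fact GLn_mul1 : left_id GLn_one GLn_mul.
Proof. by move=> x; apply: val_inj; rewrite /= mul1mx. Qed.
Fact GLn_mulr1 : right_id GLn_one GLn_mul.
Proof. by move=> x; apply: val_inj; rewrite /= mulmx1. Qed.
Fact GLn_mulV : left_inverse GLn_one GLn_inv GLn_mul.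
Proof. by move=> x; apply: val_inj; rewrite /= mulVmx ?(valP x). Qed.
Fact GLn_mulrV : right_inverse GLn_one GLn_inv GLn_mul.
Proof. by move=> x; apply: val_inj; rewrite /= mulmxV ?(valP x). Qed.

HB.instance Definition _ := isGroup.Build GLn
  GLn_mulA GLn_mul1 GLn_mulr1 GLn_mulV GLn_mulrV.

Lemma GLn_val1 : val (1%g : GLn) = 1%:M. Proof. by []. Qed.
Lemma GLn_valM (A B : GLn) : val (A * B)%g = val A *m val B. Proof. by []. Qed.

(* is_trig_mx is lower triangularity, hence the transposition. *)
Definition uppertri : {pred GLn} := fun A => is_trig_mx (val A)^T.

Lemma uppertriP (A : GLn) :
  reflect (forall i j : 'I_n, (j < i)%N -> val A i j = 0) (A \in uppertri).
Proof.
apply: (iffP is_trig_mxP) => tA i j lij; first by have := tA j i lij; rewrite mxE.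
by rewrite mxE tA.
Qed.

Definition unitri : {pred GLn} :=
  fun A => (A \in uppertri) && [forall i, val A i i == 1].

Lemma unitriP (A : GLn) :
  reflect (A \in uppertri /\ forall i, val A i i = 1) (A \in unitri).
Proof.
apply: (iffP andP) => -[tA dA]; split=> //; first by move=> i; apply/eqP/(forallP dA).
by apply/forallP => i; rewrite dA.
Qed.

Lemma uppertri_mulE (A B : GLn) : A \in uppertri -> B \in uppertri ->
  forall i j : 'I_n, (j <= i)%N ->
  val (A * B)%g i j = (if j == i then val A i i * val B i i else 0).
Proof.
move=> /uppertriP tA /uppertriP tB i j; rewrite leq_eqVlt => lji.
rewrite GLn_valM mxE (bigD1 i) //= big1 ?addr0; last first.
  move=> k; rewrite -val_eqE /= neq_ltn => /orP[ki|ik]; first by rewrite tA ?mul0r.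
  rewrite (tB k) ?mulr0 //; case/orP: lji => [/eqP -> //|/ltn_trans]; exact.
case: eqP => [-> //|/eqP ne]; rewrite tB ?mulr0 //.
by case/orP: lji => // ji; case/eqP: ne; apply/val_inj/eqP.
Qed.

Lemma uppertri_mul (A B : GLn) :
  A \in uppertri -> B \in uppertri -> (A * B)%g \in uppertri.
Proof.
move=> tA tB; apply/uppertriP => i j ji.
by rewrite uppertri_mulE 1?ltnW // -val_eqE ltn_eqF.
Qed.

Lemma uppertri_diag (A : GLn) : A \in uppertri -> forall i, val A i i != 0.
Proof.
move=> tA i; have := valP A; rewrite unitmxE -det_tr det_trig // unitfE.
by move=> /prodf_neq0 /(_ i isT); rewrite mxE.
Qed.

Lemma uppertri_inv (A : GLn) : A \in uppertri -> (A^-1)%g \in uppertri.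
Proof.
move=> tA; have dA := uppertri_diag tA; move/uppertriP: (tA) => {}tA.
apply/uppertriP => i j; have [m] := ubnP (j : nat); elim: m j => // m IHm j.
rewrite ltnS => jm ji; set B := val _.
have: (B *m val A) i j = 0.
  by rewrite -GLn_valM mulVg mxE -val_eqE gtn_eqF.
rewrite mxE (bigD1 j) //= big1 ?addr0 => [|k].
  by move/eqP; rewrite mulf_eq0 (negPf (dA j)) orbF => /eqP.
rewrite -val_eqE /= neq_ltn => /orP[kj|jk]; last by rewrite tA ?mulr0.
by rewrite /B (IHm k (leq_trans kj jm) (ltn_trans kj ji)) mul0r.
Qed.

Lemma uppertri_closed : group_closed uppertri.
Proof.
split; first by apply/uppertriP => i j ji; rewrite mxE -val_eqE gtn_eqF.
by move=> A B tA tB; apply: uppertri_mul => //; apply: uppertri_inv.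
Qed.

Lemma unitri_closed : group_closed unitri.
Proof.
split.
  by apply/unitriP; split=> [|i]; [exact: uppertri_closed.1|rewrite mxE eqxx].
move=> A B /unitriP[tA dA] /unitriP[tB dB]; apply/unitriP.
split=> [|i]; first exact: uppertri_closed.2.
have tBV := uppertri_inv tB.
have := uppertri_mulE tBV tB (leqnn i); rewrite eqxx mulVg dB mulr1 => dBV.
by rewrite uppertri_mulE // eqxx dA -dBV mul1r mxE eqxx.
Qed.

Lemma unitri_conj (T A : GLn) : T \in uppertri -> A \in unitri ->
  (T * A * T^-1)%g \in unitri.
Proof.
move=> tT /unitriP[tA dA]; have tTV := uppertri_inv tT.
have tTA := uppertri_mul tT tA.
apply/unitriP; split=> [|i]; first exact: uppertri_mul.
have := uppertri_mulE tT tTV (leqnn i); rewrite eqxx mulgV => E.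
rewrite uppertri_mulE // eqxx [X in X * _](uppertri_mulE tT tA (leqnn i)) eqxx.
by rewrite dA mulr1 -E mxE eqxx.
Qed.

Definition Tn := {A : GLn | A \in uppertri}.
HB.instance Definition _ := SubChoice.on Tn.
HB.instance Definition _ :=
  SubChoice_isSubGroup.Build GLn uppertri Tn uppertri_closed.

Definition UTn := {A : GLn | A \in unitri}.
HB.instance Definition _ := SubChoice.on UTn.
HB.instance Definition _ :=
  SubChoice_isSubGroup.Build GLn unitri UTn unitri_closed.

Definition dmx (i : 'I_n) (a : units F) : 'M[F]_n :=
  diag_mx (\row_j (if j == i then val a else 1)).

Fact dmx_unit i a : dmx i a \in unitmx.
Proof.
rewrite unitmxE det_diag unitfE prodf_seq_neq0; apply/allP => j _.
by rewrite mxE; case: (j == i); rewrite ?oner_neq0 ?(valP a).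
Qed.

Definition dGL (i : 'I_n) (a : units F) : GLn :=
  exist (fun A : 'M[F]_n => A \in unitmx) (dmx i a) (dmx_unit i a).

(* Indices start at 0, so the positions 1, ..., n-1 are the i with i.+1 < n. *)
Definition bdiag : {pred GLn} := fun A =>
  `[< exists a : 'I_n -> units F, A = \prod_(i < n | (i.+1 < n)%N) dGL i (a i) >]%g.

Lemma val_prod_dGL (a : 'I_n -> units F) :
  val (\prod_(i < n | (i.+1 < n)%N) dGL i (a i))%g =
  diag_mx (\row_j (if (j.+1 < n)%N then val (a j) else 1)).
Proof.
have aux (r : seq 'I_n) : uniq r ->
  val (\prod_(i <- r | (i.+1 < n)%N) dGL i (a i))%g =
  diag_mx (\row_j (if (j \in r) && (j.+1 < n)%N then val (a j) else 1)).
  elim: r => [_|i r IHr /= /andP[ir ur]].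
    rewrite big_nil GLn_val1; apply/matrixP => k l.
    by rewrite !mxE.
  rewrite big_cons; case: ifP => lti; last first.
    rewrite IHr //; congr diag_mx; apply/rowP => j; rewrite !mxE inE.
    by case: eqP => [->|//]; rewrite lti !andbF.
  rewrite GLn_valM IHr // [val _]/(dmx i (a i)) /dmx mulmx_diag.
  congr diag_mx; apply/rowP => j; rewrite !mxE inE.
  case: eqP => [->|_] /=; first by rewrite (negPf ir) lti mulr1.
  by rewrite mul1r.
rewrite aux ?index_enum_uniq //; congr diag_mx; apply/rowP => j.
by rewrite !mxE mem_index_enum.
Qed.

Lemma bdiag_closed : group_closed bdiag.
Proof.
split.
  apply/asboolP; exists (fun=> 1%g); apply: val_inj; rewrite val_prod_dGL.
  by apply/matrixP => i j; rewrite !mxE if_same.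
move=> A B /asboolP[a ->] /asboolP[b ->]; apply/asboolP.
exists (fun i => a i / b i)%g.
set P := (\prod_(i < n | _) dGL i (a i))%g; set Q := (\prod_(i < n | _) _)%g.
apply: (@mulIg _ Q); rewrite mulgVK; apply: val_inj.
rewrite GLn_valM !val_prod_dGL mulmx_diag.
congr diag_mx; apply/rowP => j; rewrite !mxE.
by case: ifP; rewrite ?mulr1 //= divfK ?(valP (b j)).
Qed.

Definition Bn := {A : GLn | A \in bdiag}.
HB.instance Definition _ := SubChoice.on Bn.
HB.instance Definition _ :=
  SubChoice_isSubGroup.Build GLn bdiag Bn bdiag_closed.

Fact Bn_mulC : commutative (@monoid.mul Bn).
Proof.
move=> x y; apply: val_inj; rewrite !valM; apply: val_inj.
have /asboolP[a ->] := valP x; have /asboolP[b ->] := valP y.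
rewrite !GLn_valM !val_prod_dGL !mulmx_diag.
by congr diag_mx; apply/rowP => j; rewrite !mxE mulrC.
Qed.
HB.instance Definition _ := Group_isAbelian.Build Bn Bn_mulC.

Lemma Bn_uppertri (b : Bn) : val b \in uppertri.
Proof.
have /asboolP[a E] := valP b; apply/uppertriP => i j ji.
by rewrite E val_prod_dGL mxE -val_eqE gtn_eqF.
Qed.

Definition Bconj (b : Bn) (u : UTn) : UTn :=
  exist (fun A : GLn => A \in unitri) (val b * val u * (val b)^-1)%g (unitri_conj (Bn_uppertri b) (valP u)).

Lemma val_Bconj b u : val (Bconj b u) = (val b * val u * (val b)^-1)%g.
Proof. by []. Qed.

Lemma BconjM b u v : Bconj b (u * v)%g = (Bconj b u * Bconj b v)%g.
Proof.
by apply: val_inj; rewrite [RHS]valM !val_Bconj valM !mulgA mulgVK.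
Qed.

Lemma Bconj1 u : Bconj 1%g u = u.
Proof. by apply: val_inj; rewrite val_Bconj val1 mul1g invg1 mulg1. Qed.

Lemma Bconj_1 b : Bconj b 1%g = 1%g.
Proof. by apply: val_inj; rewrite val_Bconj val1 mulg1 mulgV. Qed.

Lemma BconjMl b c u : Bconj (b * c)%g u = Bconj b (Bconj c u).
Proof. by apply: val_inj; rewrite !val_Bconj valM invgM !mulgA. Qed.

End MatrixGroups.

Arguments dGL {F n} i a.

Section Cocycle.
Variables B Z : abGroupType.
Local Open Scope group_scope.

Definition sym_cocycle_axiom (f : B -> B -> Z) : Prop :=
  [/\ forall x y z, f (x * y) z * f x y = f x (y * z) * f y z,
      forall x, f 1 x = 1 /\ f x 1 = 1
    & forall x y, f x y = f y x].

Record sym_cocycle : Type := SymCocycle {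
  cocycle_fun :> B -> B -> Z;
  cocycleP : sym_cocycle_axiom cocycle_fun }.

End Cocycle.

(* A record and not an alias of Z * B, on which the library already puts the
   direct product. *)
Record cocycle_ext (B Z : abGroupType) (f : sym_cocycle B Z) : Type :=
  Ext { ext_ker : Z; ext_quo : B }.

Section CocycleExtension.
Variables (B Z : abGroupType) (f : sym_cocycle B Z).
Local Open Scope group_scope.
Local Notation cocycle_ext := (cocycle_ext f).
Local Notation Ext := (Ext f).

Definition ext_pair (x : cocycle_ext) : Z * B := (ext_ker x, ext_quo x).
Definition pair_ext (p : Z * B) : cocycle_ext := Ext p.1 p.2.
Fact ext_pairK : cancel ext_pair pair_ext. Proof. by case. Qed.
HB.instance Definition _ := Choice.copy cocycle_ext (can_type ext_pairK).

Definition ext_one : cocycle_ext := Ext 1 1.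
Definition ext_mul (x y : cocycle_ext) : cocycle_ext :=
  Ext (ext_ker x * ext_ker y * f (ext_quo x) (ext_quo y))
      (ext_quo x * ext_quo y).
Definition ext_inv (x : cocycle_ext) : cocycle_ext :=
  Ext (ext_ker x * f (ext_quo x) (ext_quo x)^-1)^-1 (ext_quo x)^-1.

Fact ext_mulA : associative ext_mul.
Proof.
have [fA _ _] := cocycleP f.
move=> [z1 b1] [z2 b2] [z3 b3]; rewrite /ext_mul /=.
congr Ext; last by rewrite mulgA.
rewrite -!mulgA; congr (_ * (_ * _)).
rewrite [RHS]mulgA [f b1 b2 * z3]abmulgC -mulgA; congr (_ * _).
by rewrite [RHS]abmulgC fA abmulgC.
Qed.
Fact ext_mulC : commutative ext_mul.
Proof.
have [_ _ fC] := cocycleP f.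
move=> [z1 b1] [z2 b2]; rewrite /ext_mul /= fC.
by rewrite [z1 * _]abmulgC [b1 * _]abmulgC.
Qed.
Fact ext_mul1 : left_id ext_one ext_mul.
Proof.
have [_ f1 _] := cocycleP f.
by move=> [z b]; rewrite /ext_mul /= (f1 b).1 mulg1 !mul1g.
Qed.
Fact ext_mulr1 : right_id ext_one ext_mul.
Proof. by move=> x; rewrite ext_mulC ext_mul1. Qed.
Fact ext_mulrV : right_inverse ext_one ext_inv ext_mul.
Proof.
move=> [z b]; rewrite /ext_mul /ext_inv /= mulgV; congr Ext.
by rewrite -mulgA [_^-1 * _]abmulgC mulgA mulgV.
Qed.
Fact ext_mulV : left_inverse ext_one ext_inv ext_mul.
Proof. by move=> x; rewrite ext_mulC ext_mulrV. Qed.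

HB.instance Definition _ := isGroup.Build cocycle_ext
  ext_mulA ext_mul1 ext_mulr1 ext_mulV ext_mulrV.
HB.instance Definition _ := Group_isAbelian.Build cocycle_ext ext_mulC.

End CocycleExtension.

Section Deformation.
Variables (L : fieldType) (n : nat) (Z : abGroupType).
Variable f : sym_cocycle (Bn L n) Z.
Local Open Scope group_scope.

(* Here cocycle_ext f is the group D_n(L,f,Z). *)
Record Tn_deform : Type := Tdef { tdef_uni : UTn L n; tdef_ext : cocycle_ext f }.

Definition tdef_pair (x : Tn_deform) : UTn L n * cocycle_ext f :=
  (tdef_uni x, tdef_ext x).
Definition pair_tdef (p : UTn L n * cocycle_ext f) : Tn_deform := Tdef p.1 p.2.
Fact tdef_pairK : cancel tdef_pair pair_tdef. Proof. by case. Qed.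
HB.instance Definition _ := Choice.copy Tn_deform (can_type tdef_pairK).

Definition tdef_one : Tn_deform := Tdef 1 1.
Definition tdef_mul (x y : Tn_deform) : Tn_deform :=
  Tdef (tdef_uni x * Bconj (ext_quo (tdef_ext x)) (tdef_uni y))
       (tdef_ext x * tdef_ext y).
Definition tdef_inv (x : Tn_deform) : Tn_deform :=
  Tdef (Bconj (ext_quo (tdef_ext x))^-1 (tdef_uni x)^-1) (tdef_ext x)^-1.

Fact tdef_mulA : associative tdef_mul.
Proof.
move=> [u1 x1] [u2 x2] [u3 x3]; rewrite /tdef_mul /=.
by congr Tdef; rewrite ?BconjM ?BconjMl !mulgA.
Qed.
Fact tdef_mul1 : left_id tdef_one tdef_mul.
Proof. by move=> [u x]; rewrite /tdef_mul /= Bconj1 !mul1g. Qed.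
Fact tdef_mulr1 : right_id tdef_one tdef_mul.
Proof. by move=> [u x]; rewrite /tdef_mul /= Bconj_1 !mulg1. Qed.
Fact tdef_mulV : left_inverse tdef_one tdef_inv tdef_mul.
Proof.
move=> [u x]; rewrite /tdef_mul /tdef_inv /= mulVg; congr Tdef.
by rewrite -BconjM mulVg Bconj_1.
Qed.
Fact tdef_mulrV : right_inverse tdef_one tdef_inv tdef_mul.
Proof.
move=> [u x]; rewrite /tdef_mul /tdef_inv /= -BconjMl !mulgV Bconj1.
by rewrite mulgV.
Qed.

HB.instance Definition _ := isGroup.Build Tn_deform
  tdef_mulA tdef_mul1 tdef_mulr1 tdef_mulV tdef_mulrV.

End Deformation.

(* Main.v *)
Require Import Defs.
From HB Require Import structures.
From mathcomp Require Import all_boot all_algebra.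
From mathcomp Require Import boolp classical_sets cardinality.
Import GRing.Theory.
Local Open Scope ring_scope.
Set Implicit Arguments.
Unset Strict Implicit.
Unset Printing Implicit Defensive.

(** The group T_n(F) knows its field.  Let N be the set of commutators that
    commute with all commutators; in T_n(F) it is the root subgroup of the
    matrices 1 + k E_1n, and T_n(F) acts on it by conjugation through all of
    F^x.  Hence N is the additive group of F, and once some u <> 1 in N is
    chosen as the unit, multiplication is recovered from the action: x y = z
    when some t carries u to x and y to z.  This interpretation of F uses no
    parameter except u, and replacing u by another element only rescales it.
    So each ring sentence true in F becomes a group sentence quantified over all
    u, which passes to H; this is why the field L that H interprets satisfies
    L == F (field_equiv_of_coordinates), without any saturation argument.

    The rest of the structure is a single existential sentence.  From finitely
    many parameters, the elementary matrices and the diagonal matrices with one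
    entry 2, every matrix entry of a unipotent x is a word in x with value in N,
    the diagonal group is a centralizer, and the ratios of the diagonal entries
    of t are again words in t.  The predicate has_frame says that these words
    behave like matrix entries: they identify the unipotent part with the
    unitriangular matrices over N, they multiply by the matrix product formula,
    and the diagonal part acts on them in the right way with the center as
    kernel of the ratios.  It holds in T_n(F) (has_frame_Tn), hence in H, and a
    group with a frame is an extension of the required form
    (group_iso_of_frame): the cocycle measures how far a section of the ratio
    map from the diagonal part onto B_n(L) is from a homomorphism.

    The center is parameter-free definable, so elementary equivalence passes to
    it by relativising quantifiers. *)

(** * First-order transfer *)

Section Coincidence.
Variables (T : Type) (tvars : T -> seq nat) (M : Type) (ev : (nat -> M) -> T -> M).
Hypothesis ev_ext :
  forall e e' t, {in tvars t, e =1 e'} -> ev e t = ev e' t.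

Lemma sat_ext phi e e' :
  {in free_vars tvars phi, e =1 e'} -> sat ev e phi <-> sat ev e' phi.
Proof.
elim: phi e e' => [|t u|p IHp q IHq|p IHp q IHq|p IHp q IHq|i p IHp|i p IHp] e e' /=.
- by [].
- move=> E; rewrite (ev_ext (t := t) (e' := e')); last first.
    by move=> j jt; apply: E; rewrite mem_cat jt.
  rewrite (ev_ext (t := u) (e' := e')) // => j ju.
  by apply: E; rewrite mem_cat ju orbT.
- move=> E; rewrite (IHp e e') ?(IHq e e') //;
    by move=> j jpq; apply: E; rewrite mem_cat jpq ?orbT.
- move=> E; rewrite (IHp e e') ?(IHq e e') //;
    by move=> j jpq; apply: E; rewrite mem_cat jpq ?orbT.
- move=> E; rewrite (IHp e e') ?(IHq e e') //;
    by move=> j jpq; apply: E; rewrite mem_cat jpq ?orbT.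
- move=> E; have Eu x : sat ev (upd e i x) p <-> sat ev (upd e' i x) p.
    by apply: IHp => j jp; rewrite /upd; case: eqP => // /eqP ji;
       apply: E; rewrite mem_filter ji.
  by split=> h x; apply/Eu.
- move=> E; have Eu x : sat ev (upd e i x) p <-> sat ev (upd e' i x) p.
    by apply: IHp => j jp; rewrite /upd; case: eqP => // /eqP ji;
       apply: E; rewrite mem_filter ji.
  by split=> -[x /Eu h]; exists x.
Qed.

Lemma sat_closed phi e e' :
  free_vars tvars phi = [::] -> sat ev e phi <-> sat ev e' phi.
Proof. by move=> phi0; apply: sat_ext => j; rewrite phi0. Qed.

End Coincidence.

Lemma geval_ext (G : groupType) (e e' : nat -> G) t :
  {in gvars t, e =1 e'} -> geval e t = geval e' t.
Proof.
elim: t => [i|//|t IHt u IHu|t IHt] /= E; first by apply: E; rewrite inE.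
  by rewrite IHt ?IHu // => j jt; apply: E; rewrite mem_cat jt ?orbT.
by rewrite IHt.
Qed.

Lemma reval_ext (R : nzRingType) (e e' : nat -> R) t :
  {in rvars t, e =1 e'} -> reval e t = reval e' t.
Proof.
elim: t => [i|//|//|t IHt u IHu|t IHt|t IHt u IHu] /= E.
- by apply: E; rewrite inE.
- by rewrite IHt ?IHu // => j jt; apply: E; rewrite mem_cat jt ?orbT.
- by rewrite IHt.
- by rewrite IHt ?IHu // => j jt; apply: E; rewrite mem_cat jt ?orbT.
Qed.

(** Formulas are never written out below.  A family of group elements, or a
    predicate, that depends uniformly on a group and on a valuation is shown to
    be expressible by closure rules that follow its Coq syntax. *)
Definition is_word (t : forall G : groupType, (nat -> G) -> G) :=
  exists s, forall G e, geval e s = t G e.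

Definition definable (P : forall G : groupType, (nat -> G) -> Prop) :=
  exists phi, forall G e, sat (@geval G) e phi <-> P G e.

Section Words.
Local Open Scope group_scope.

Lemma word_var k : is_word (fun G e => e k).
Proof. by exists (GVar k). Qed.

Lemma word1 : is_word (fun G e => 1).
Proof. by exists GOne. Qed.

Lemma wordM t u : is_word t -> is_word u -> is_word (fun G e => t G e * u G e).
Proof. by move=> [s E] [r E']; exists (GMul s r) => G e /=; rewrite E E'. Qed.

Lemma wordV t : is_word t -> is_word (fun G e => (t G e)^-1).
Proof. by move=> [s E]; exists (GInv s) => G e /=; rewrite E. Qed.

Lemma wordJ t u : is_word t -> is_word u -> is_word (fun G e => t G e ^ u G e).
Proof. by move=> ht hu; apply: wordM; [exact: wordV|exact: wordM]. Qed.

Lemma wordR t u : is_word t -> is_word u -> is_word (fun G e => [~ t G e, u G e]).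
Proof. by move=> ht hu; apply: wordM; [exact: wordV|exact: wordJ]. Qed.

Lemma word_prod (I : Type) (r : seq I) (t : I -> forall G : groupType, (nat -> G) -> G) :
  (forall i, is_word (t i)) -> is_word (fun G e => \prod_(i <- r) t i G e).
Proof.
move=> ht; elim: r => [|i r [s Es]].
  by exists GOne => G e; rewrite big_nil.
by have [si Ei] := ht i; exists (GMul si s) => G e; rewrite big_cons /= Es Ei.
Qed.

Fixpoint rename_gterm (r : nat -> nat) (t : gterm) : gterm :=
  match t with
  | GVar i => GVar (r i)
  | GOne => GOne
  | GMul t u => GMul (rename_gterm r t) (rename_gterm r u)
  | GInv t => GInv (rename_gterm r t)
  end.

Lemma geval_rename r (G : groupType) (e : nat -> G) t :
  geval e (rename_gterm r t) = geval (fun j => e (r j)) t.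
Proof. by elim: t => //= [t -> u ->|t ->]. Qed.

Lemma word_rename r t : is_word t -> is_word (fun G e => t G (fun j => e (r j))).
Proof. by move=> [s E]; exists (rename_gterm r s) => G e; rewrite geval_rename E. Qed.

End Words.

Lemma def_eq t u : is_word t -> is_word u -> definable (fun G e => t G e = u G e).
Proof. by move=> [s E] [r E']; exists (FEq s r) => G e /=; rewrite E E'. Qed.

Lemma def_const (Q : Prop) : definable (fun _ _ => Q).
Proof.
have [q|nq] := pselect Q; last by exists (FFalse _) => G e /=; split.
by exists (FImp (FFalse _) (FFalse _)) => G e /=; split.
Qed.

Lemma def_and P Q : definable P -> definable Q ->
  definable (fun G e => P G e /\ Q G e).
Proof. by move=> [p E] [q E']; exists (FAnd p q) => G e /=; rewrite E E'. Qed.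

Lemma def_or P Q : definable P -> definable Q ->
  definable (fun G e => P G e \/ Q G e).
Proof. by move=> [p E] [q E']; exists (FOr p q) => G e /=; rewrite E E'. Qed.

Lemma def_imp P Q : definable P -> definable Q ->
  definable (fun G e => P G e -> Q G e).
Proof. by move=> [p E] [q E']; exists (FImp p q) => G e /=; rewrite E E'. Qed.

Lemma def_not P : definable P -> definable (fun G e => ~ P G e).
Proof. by move=> hP; exact: def_imp hP (def_const False). Qed.

Lemma def_iff P Q : definable P -> definable Q ->
  definable (fun G e => P G e <-> Q G e).
Proof. by move=> hP hQ; apply: def_and; apply: def_imp. Qed.

Lemma def_ext P Q : (forall G e, P G e <-> Q G e) -> definable P -> definable Q.
Proof. by move=> PQ [p E]; exists p => G e; rewrite E. Qed.

(** Bound variables are renamed to fresh ones, since the values of [r] could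
    capture them. *)
Lemma exists_rename phi (r : nat -> nat) : exists phi', forall (G : groupType) (e : nat -> G),
  sat (@geval G) e phi' <-> sat (@geval G) (fun j => e (r j)) phi.
Proof.
have fresh p i (r0 : nat -> nat) : exists m, forall (G : groupType) (e : nat -> G) x,
    sat (@geval G) (fun j => upd e m x (upd r0 i m j)) p <->
    sat (@geval G) (upd (fun j => e (r0 j)) i x) p.
  exists (\max_(j <- free_vars gvars p) r0 j).+1 => G e x.
  apply: sat_ext => [? ? ?|j jp]; first exact: geval_ext.
  rewrite /upd; case: (j == i); rewrite ?eqxx //; case: eqP => // E.
  by have := leq_bigmax_seq (F := r0) j jp isT; rewrite E ltnn.
elim: phi r => [|t u|p IHp q IHq|p IHp q IHq|p IHp q IHq|i p IHp|i p IHp] r.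
- by exists (FFalse _).
- exists (FEq (rename_gterm r t) (rename_gterm r u)) => G e /=.
  by rewrite !geval_rename.
- have [p' Ep] := IHp r; have [q' Eq] := IHq r.
  by exists (FAnd p' q') => G e /=; rewrite Ep Eq.
- have [p' Ep] := IHp r; have [q' Eq] := IHq r.
  by exists (FOr p' q') => G e /=; rewrite Ep Eq.
- have [p' Ep] := IHp r; have [q' Eq] := IHq r.
  by exists (FImp p' q') => G e /=; rewrite Ep Eq.
- have [m Em] := fresh p i r; have [p' Ep] := IHp (upd r i m).
  exists (FForall m p') => G e /=.
  by split=> h x; [apply/Em/Ep|apply/Ep/Em].
- have [m Em] := fresh p i r; have [p' Ep] := IHp (upd r i m).
  exists (FExists m p') => G e /=.
  by split=> -[x h]; exists x; [apply/Em/Ep|apply/Ep/Em].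
Qed.

Lemma def_rename r P : definable P -> definable (fun G e => P G (fun j => e (r j))).
Proof.
move=> [p E]; have [p' E'] := exists_rename p r.
by exists p' => G e; rewrite E' E.
Qed.

(** This is what allows quantification over finite families of group elements. *)
Lemma def_exists_prefix k P : definable P ->
  definable (fun G e => exists2 e', (forall j, (k <= j)%N -> e' j = e j) & P G e').
Proof.
move=> hP; elim: k => [|k [p E]].
  apply: def_ext hP => G e; split=> [h|[e' Ee h]]; first by exists e.
  by rewrite (_ : e = e') //; apply/funext => j; rewrite Ee.
exists (FExists k p) => G e /=; split=> [[x /E[e' Ee h]]|[e' Ee h]].
  by exists e' => // j kj; rewrite Ee ?(ltnW kj) // /upd gtn_eqF.
exists (e' k); apply/E; exists e' => // j; rewrite leq_eqVlt /upd => /orP[/eqP->|kj].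
  by rewrite eqxx.
by rewrite gtn_eqF // Ee.
Qed.

(** In this rule and the next ones the bound object takes the first variables of
    the valuation, and the other variables are shifted, as with de Bruijn
    indices. *)
Lemma def_exf (I : finType) (P : forall G : groupType, (nat -> G) -> (I -> G) -> Prop) :
  definable (fun G e => P G (fun j => e (#|I| + j)%N) (fun i => e (enum_rank i))) ->
  definable (fun G e => exists x : I -> G, P G e x).
Proof.
move=> /(def_exists_prefix #|I|)/(def_rename (fun j => j - #|I|)%N).
apply: def_ext => G e; split=> [[e' Ee h]|[x h]].
  exists (fun i => e' (enum_rank i)); rewrite (_ : e = fun j => e' (#|I| + j)%N) //.
  by apply/funext => j; rewrite Ee ?leq_addr // addKn.
exists (fun j => if insub j is Some i then x (@enum_val I I i) else e (j - #|I|)%N) => [j Ij|].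
  by rewrite insubN // -leqNgt.
rewrite (_ : (fun j => _) = e).
  by rewrite (_ : (fun i => _) = x) //; apply/funext => i; rewrite valK enum_rankK.
by apply/funext => j; rewrite insubN ?addKn // -leqNgt leq_addr.
Qed.

Lemma def_ex (P : forall G : groupType, (nat -> G) -> G -> Prop) :
  definable (fun G e => P G (fun j => e j.+1) (e 0%N)) ->
  definable (fun G e => exists x, P G e x).
Proof.
move=> [p E]; apply: def_ext (def_rename predn (P := fun G e => exists x, P G (fun j => e j.+1) x) _).
  by [].
exists (FExists 0 p) => G e /=; split=> -[x h]; exists x; first by have /E := h.
by apply/(E G (upd e 0 x)).
Qed.

Lemma def_all (P : forall G : groupType, (nat -> G) -> G -> Prop) :
  definable (fun G e => P G (fun j => e j.+1) (e 0%N)) ->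
  definable (fun G e => forall x, P G e x).
Proof.
move=> /def_not/(def_ex (P := fun G e x => ~ P G e x))/def_not.
by apply: def_ext => G e; rewrite -forallNE; split=> h x; [apply: contrapT|move=> /(_ (h x))].
Qed.

Lemma def_allf (I : finType) (P : forall G : groupType, (nat -> G) -> (I -> G) -> Prop) :
  definable (fun G e => P G (fun j => e (#|I| + j)%N) (fun i => e (enum_rank i))) ->
  definable (fun G e => forall x : I -> G, P G e x).
Proof.
move=> /def_not/(def_exf (P := fun G e x => ~ P G e x))/def_not.
by apply: def_ext => G e; rewrite -forallNE; split=> h x; [apply: contrapT|move=> /(_ (h x))].
Qed.

Lemma def_fin (I : finType) (P : I -> forall G : groupType, (nat -> G) -> Prop) :
  (forall i, definable (P i)) -> definable (fun G e => forall i, P i G e).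
Proof.
move=> hP; suff: definable (fun G e => forall i, i \in enum I -> P i G e).
  by apply: def_ext => G e; split=> h i *; apply: h => //; rewrite mem_enum.
elim: (enum I) => [|i s IHs].
  by apply: def_ext (def_const True) => G e; split.
apply: def_ext (def_and (hP i) IHs) => G e; split=> [[hi hs] j|h].
  by rewrite inE => /orP[/eqP->|/hs].
by split=> [|j js]; apply: h; rewrite inE ?eqxx ?js ?orbT.
Qed.

(** A formula valid in G under all valuations has a valid universal closure,
    which is a sentence. *)
Lemma definable_transfer (P : forall G : groupType, (nat -> G) -> Prop) (H G : groupType) :
  definable P -> group_equiv H G -> (forall e, P G e) -> forall e, P H e.
Proof.
move=> [p E] HG hG.
have closure k : exists2 q, {subset free_vars gvars q <= [seq j <- free_vars gvars p | (k <= j)%N]}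
    & forall (K : groupType) (e : nat -> K), sat (@geval K) e q <->
       forall e', (forall j, (k <= j)%N -> e' j = e j) -> P K e'.
  elim: k => [|k [q q_vars Eq]].
    exists p => [j|K e]; first by rewrite mem_filter.
    rewrite E; split=> [h e' Ee|]; last exact.
    by rewrite (_ : e' = e) //; apply/funext => j; rewrite Ee.
  exists (FForall k q) => [j /=|K e /=].
    rewrite mem_filter => /andP[jk /q_vars]; rewrite !mem_filter => /andP[kj ->].
    by rewrite ltn_neqAle eq_sym jk kj.
  split=> [h e' Ee|h x].
    apply: (Eq K (upd e k (e' k))).1 (h _) _ _ => j.
    by rewrite leq_eqVlt /upd => /orP[/eqP->|kj]; rewrite ?eqxx // gtn_eqF ?Ee.
  by apply/Eq => e' Ee; apply: h => j kj; rewrite Ee ?(ltnW kj) // /upd gtn_eqF.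
have [q q_vars Eq] := closure (\max_(j <- free_vars gvars p) j).+1.
have q0 : free_vars gvars q = [::].
  case: (free_vars gvars q) q_vars => // j s /(_ j); rewrite inE eqxx => /(_ isT).
  rewrite mem_filter => /andP[+ jp].
  by rewrite ltnNge (leq_bigmax_seq (F := id) j jp).
move=> e; apply: ((Eq H e).1 _ e) => //.
by apply/(HG q q0 e (fun=> 1%g))/Eq => e' _; apply: hG.
Qed.

(** Truth in a structure that lives on the subset [dom] of a group and whose
    equations between terms are interpreted by [atom]. *)
Fixpoint relsat (T M : Type) (dom : M -> Prop) (atom : (nat -> M) -> T -> T -> Prop)
    (e : nat -> M) (phi : formula T) : Prop :=
  match phi with
  | FFalse => False
  | FEq t u => atom e t u
  | FAnd p q => relsat dom atom e p /\ relsat dom atom e q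
  | FOr p q => relsat dom atom e p \/ relsat dom atom e q
  | FImp p q => relsat dom atom e p -> relsat dom atom e q
  | FForall i p => forall x, dom x -> relsat dom atom (upd e i x) p
  | FExists i p => exists x, dom x /\ relsat dom atom (upd e i x) p
  end.

(** An interpretation computes truth in the structure [K] that it encodes along
    the parametrization [psi] of the domain. *)
Lemma relsatE (T K M : Type) (ev : (nat -> K) -> T -> K) (psi : K -> M)
    (dom : M -> Prop) (atom : (nat -> M) -> T -> T -> Prop) :
  (forall x, dom x <-> exists k, x = psi k) ->
  (forall e t u, atom (fun j => psi (e j)) t u <-> ev e t = ev e u) ->
  forall phi e, relsat dom atom (fun j => psi (e j)) phi <-> sat ev e phi.
Proof.
move=> domE atomE.
have updE e i k : upd (fun j => psi (e j)) i (psi k) = fun j => psi (upd e i k j).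
  by apply/funext => j; rewrite /upd; case: (j == i).
elim=> [|t u|p IHp q IHq|p IHp q IHq|p IHp q IHq|i p IHp|i p IHp] e //=.
- by rewrite IHp IHq.
- by rewrite IHp IHq.
- by rewrite IHp IHq.
- split=> [h k|h x /domE[k ->]]; last by rewrite updE IHp; apply: h.
  by apply/IHp; rewrite -updE; apply: h; apply/domE; exists k.
- split=> [[x [/domE[k ->]]]|[k h]]; first by rewrite updE IHp; exists k.
  by exists (psi k); split; [apply/domE; exists k|rewrite updE IHp].
Qed.

Lemma def_relsat (T : Type) (dom : forall G : groupType, G -> Prop)
    (atom : forall G : groupType, G -> (nat -> G) -> T -> T -> Prop) :
  (forall t, is_word t -> definable (fun G e => dom G (t G e))) ->
  (forall w s t u, is_word w -> (forall j, is_word (s j)) ->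
     definable (fun G e => atom G (w G e) (fun j => s j G e) t u)) ->
  forall phi w s, is_word w -> (forall j, is_word (s j)) ->
  definable (fun G e => relsat (dom G) (atom G (w G e)) (fun j => s j G e) phi).
Proof.
move=> hdom hatom.
have updE s i : (forall j, is_word (s j)) -> exists2 s', (forall j, is_word (s' j)) &
    forall G e, (fun j => s' j G e) = upd (fun j => s j G (fun j => e j.+1)) i (e 0%N).
  move=> hs; exists (fun j G e => if j == i then e 0%N else s j G (fun j => e j.+1)) => //.
  by move=> j; case: (j == i); [exact: word_var|exact: (word_rename succn (hs j))].
elim=> [|t u|p IHp q IHq|p IHp q IHq|p IHp q IHq|i p IHp|i p IHp] w s hw hs /=.
- exact: def_const.
- exact: hatom.
- by apply: def_and; [exact: IHp|exact: IHq].
- by apply: def_or; [exact: IHp|exact: IHq].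
- by apply: def_imp; [exact: IHp|exact: IHq].
- have [s' hs' Es'] := updE s i hs; apply: def_all.
  apply: def_imp; first exact/hdom/word_var.
  apply: def_ext (IHp _ s' (word_rename succn hw) hs') => G e.
  by rewrite Es'.
- have [s' hs' Es'] := updE s i hs; apply: def_ex.
  apply: def_and; first exact/hdom/word_var.
  apply: def_ext (IHp _ s' (word_rename succn hw) hs') => G e.
  by rewrite Es'.
Qed.

(** * The field acting on the commutators that centralize all commutators *)

(** In T_n(F) this is the center of UT_n(F), that is, the root subgroup of the
    upper right corner. *)
Definition inN (G : groupType) (x : G) : Prop :=
  ((exists a b, x = [~ a, b]) /\ forall a b, x * [~ a, b] = [~ a, b] * x)%g.

(** The graph of the multiplication on N with unit [u]; the first disjunct is
    the product with the zero 1. *)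
Definition mulN (G : groupType) (u x y z : G) : Prop :=
  ((x = 1 /\ z = 1) \/ exists t, u ^ t = x /\ y ^ t = z)%g.

Definition conj_field (G : groupType) (u : G) : Prop :=
  inN u /\ u <> 1%g /\ (forall x y : G, inN x -> inN y -> inN (x * y)%g) /\
  forall x y : G, inN x -> x <> 1%g -> inN y -> y <> 1%g -> exists t, (x ^ t)%g = y.

(** [psi] is an isomorphism of [K] onto the field structure of N with unit
    [u]. *)
Definition coordinates (G : groupType) (u : G) (K : fieldType) (psi : K -> G) : Prop :=
  [/\ injective psi, forall x, inN x <-> exists a, x = psi a,
      forall a b, psi (a + b) = (psi a * psi b)%g, psi 1 = u
    & forall a b z, mulN u (psi a) (psi b) z <-> z = psi (a * b)].

(** The commutators act trivially on N, so G acts on N through a commutative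
    group, and transitively outside 1.  Each x in N is u ^ t for some t that is
    unique up to elements acting trivially; multiplication by x is conjugation
    by t.  Distributivity in the second factor is that of conjugation over
    products, and commutativity of the action gives the other axioms. *)
Section ConjugationField.
Variables (G : groupType) (u : G).
Hypothesis hu : conj_field u.
Local Open Scope group_scope.

Let Nu : inN u. Proof. by case: hu. Qed.
Let u_neq1 : u <> 1. Proof. by case: hu => _ []. Qed.
Let NM (x y : G) : inN x -> inN y -> inN (x * y). Proof. by case: hu => _ [_ [+ _]]; exact. Qed.

Let N1 : inN (1 : G).
Proof. by split=> [|a b]; [exists 1, 1; rewrite commg1|rewrite mulg1 mul1g]. Qed.

Let NV (x : G) : inN x -> inN x^-1.
Proof.
move=> [[a [b ->]] hx]; split=> [|c d]; first by exists b, a; rewrite invgR.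
by apply: commute_sym; apply: commuteV; apply: commute_sym; apply: hx.
Qed.

Let NJ (x t : G) : inN x -> inN (x ^ t).
Proof.
move=> [[a [b ->]] hx]; split=> [|c d]; first by exists (a ^ t), (b ^ t); rewrite conjRg.
by rewrite -[c](conjgKV t) -[d](conjgKV t) -conjRg -!conjMg hx.
Qed.

Let NC (x y : G) : inN x -> inN y -> x * y = y * x.
Proof. by move=> [_ hx] [[a [b ->]] _]. Qed.

Let N_conjC (x s t : G) : inN x -> x ^ (s * t) = x ^ (t * s).
Proof.
move=> Nx; rewrite commgC conjgM; apply/conjg_fixP/commgP.
by have [_] := NJ (t * s) Nx; apply.
Qed.

(* A conjugator carrying u to a; for a = 1 there is none, whence the test in
   mulG below. *)
Let scal (a : G) : G :=
  if pselect (exists t, u ^ t = a) is left h then projT1 (cid h) else 1.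

Let scalP (a : G) : inN a -> a <> 1 -> u ^ scal a = a.
Proof.
move=> Na a1; have ex_t : exists t, u ^ t = a by case: hu => _ [_ [_]]; apply.
by rewrite /scal; case: pselect => // h; case: cid.
Qed.

Let scal_act (b s t : G) : inN b -> u ^ s = u ^ t -> b ^ s = b ^ t.
Proof.
move=> Nb ust; have [->|b1] := EM (b = 1); first by rewrite !conj1g.
by rewrite -(scalP Nb b1) -!conjgM ![u ^ (scal b * _)]N_conjC // !conjgM ust.
Qed.

Let mulG (a b : G) : G := if `[< a = 1 >] then 1 else b ^ scal a.

Let mul0G b : mulG 1 b = 1.
Proof. by rewrite /mulG; case: asboolP. Qed.

Let mulGE a b : a <> 1 -> mulG a b = b ^ scal a.
Proof. by rewrite /mulG; case: asboolP. Qed.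

Let mulG_N a b : inN a -> inN b -> inN (mulG a b).
Proof. by move=> Na Nb; rewrite /mulG; case: asboolP => // _; apply: NJ. Qed.

Let mulNE a b z : inN a -> inN b -> mulN u a b z <-> z = mulG a b.
Proof.
move=> Na Nb; split=> [[[-> ->]|[t [uta btz]]]|->]; first by rewrite mul0G.
  have a1 : a <> 1.
    by move=> a1; apply: u_neq1; apply/eqP; rewrite -(conjg_eq1 u t) uta a1.
  by rewrite mulGE // -btz; apply: scal_act; rewrite // scalP.
have [->|a1] := EM (a = 1); first by left; rewrite mul0G.
by right; exists (scal a); rewrite scalP // mulGE.
Qed.

Let mulGC a b : inN a -> inN b -> mulG a b = mulG b a.
Proof.
move=> Na Nb; have [->|a1] := EM (a = 1).
  by rewrite mul0G; have [->|b1] := EM (b = 1); rewrite ?mul0G // mulGE ?conj1g.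
have [->|b1] := EM (b = 1); first by rewrite mul0G mulGE ?conj1g.
by rewrite !mulGE // -{1}(scalP Nb b1) -{2}(scalP Na a1) -!conjgM N_conjC.
Qed.

Let mulGA a b c : inN a -> inN b -> inN c -> mulG a (mulG b c) = mulG (mulG a b) c.
Proof.
move=> Na Nb Nc; have [->|a1] := EM (a = 1); first by rewrite !mul0G.
have [->|b1] := EM (b = 1); first by rewrite (mulGE 1 a1) conj1g !mul0G mulGE ?conj1g.
have ab1 : b ^ scal a <> 1 by move/eqP; rewrite conjg_eq1 => /eqP.
rewrite (mulGE b a1) (mulGE c b1) !mulGE // -conjgM; apply: scal_act => //.
by rewrite conjgM !scalP //; apply: NJ.
Qed.

Let mulGDl a b c : inN a -> inN b -> inN c -> mulG (a * b) c = mulG a c * mulG b c.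
Proof.
move=> Na Nb Nc; rewrite [mulG (a * b) c]mulGC ?[mulG a c]mulGC ?[mulG b c]mulGC //.
  by have [->|c1] := EM (c = 1); rewrite ?mul0G ?mulg1 // !mulGE // conjMg.
exact: NM.
Qed.

Let mul1G b : inN b -> mulG u b = b.
Proof.
by move=> Nb; rewrite mulGE // -[RHS]conjg1; apply: scal_act; rewrite ?conjg1 ?scalP.
Qed.

Definition conj_field_type := let _ := hu in {x : G | `[< inN x >]}.
Local Notation L := conj_field_type.
HB.instance Definition _ := SubChoice.on L.

Let Nval (x : L) : inN (val x). Proof. exact/asboolP/(valP x). Qed.
Let mkL (x : G) (Nx : inN x) : L := exist _ x (introT (asboolP _) Nx).

Let addL (x y : L) : L := mkL (NM (Nval x) (Nval y)).
Let oppL (x : L) : L := mkL (NV (Nval x)).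
Let zeroL : L := mkL N1.

Fact addLA : associative addL.
Proof. by move=> x y z; apply: val_inj; exact: mulgA. Qed.
Fact addLC : commutative addL.
Proof. by move=> x y; apply: val_inj; exact: NC (Nval x) (Nval y). Qed.
Fact add0L : left_id zeroL addL.
Proof. by move=> x; apply: val_inj; exact: mul1g. Qed.
Fact addNL : left_inverse zeroL oppL addL.
Proof. by move=> x; apply: val_inj; exact: mulVg. Qed.
HB.instance Definition _ := GRing.isZmodule.Build L addLA addLC add0L addNL.

Let oneL : L := mkL Nu.
Let mulL (x y : L) : L := mkL (mulG_N (Nval x) (Nval y)).

Fact mulLA : associative mulL.
Proof. by move=> x y z; apply: val_inj; exact: mulGA (Nval x) (Nval y) (Nval z). Qed.
Fact mulLC : commutative mulL.
Proof. by move=> x y; apply: val_inj; exact: mulGC (Nval x) (Nval y). Qed.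
Fact mul1L : left_id oneL mulL.
Proof. by move=> x; apply: val_inj; exact: mul1G (Nval x). Qed.
Fact mulLDl : left_distributive mulL addL.
Proof. by move=> x y z; apply: val_inj; exact: mulGDl (Nval x) (Nval y) (Nval z). Qed.
Fact oneL_neq0 : oneL != zeroL.
Proof. by apply/eqP => /(congr1 val). Qed.
HB.instance Definition _ :=
  GRing.Zmodule_isComNzRing.Build L mulLA mulLC mul1L mulLDl oneL_neq0.

Let invL (x : L) : L := if x == 0%R then 0%R else mkL (NJ (scal (val x))^-1 Nu).

Fact mulVL (x : L) : (x != 0 -> invL x * x = 1)%R.
Proof.
rewrite /invL => x0; rewrite (negPf x0) mulrC; apply: val_inj => /=.
have x1 : val x <> 1 by move=> x1; case/eqP: x0; apply: val_inj.
by rewrite mulGE // -conjgM mulVg conjg1.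
Qed.
Fact invL0 : invL 0%R = 0%R. Proof. by rewrite /invL eqxx. Qed.
HB.instance Definition _ := GRing.ComNzRing_isField.Build L mulVL invL0.

Lemma conj_field_coordinates : coordinates u (val : L -> G).
Proof.
split=> //; first exact: val_inj.
  by move=> x; split=> [Nx|[a ->]]; [exists (mkL Nx)|].
by move=> a b z; exact: mulNE (Nval a) (Nval b).
Qed.

End ConjugationField.

Lemma exists_coordinates (G : groupType) (u : G) : conj_field u ->
  exists (K : fieldType) (psi : K -> G), coordinates u psi.
Proof. by move=> hu; exists (conj_field_type hu), val; apply: conj_field_coordinates. Qed.

(** * Interpreting the field and the center in the group *)
(** Both tactics dispatch on the head symbol of the word or predicate and apply
    the closure rule for it. *)
Ltac word_tac :=
  repeat (cbv beta; match goal with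
  | h : forall j, is_word (?s j) |- is_word (?s _) => exact: h
  | h : is_word ?t |- is_word ?t => exact: h
  | |- forall _, _ => move=> ?
  | |- is_word (fun G e => e _) => exact: word_var
  | |- is_word (fun G e => ?t G e) => change (is_word t)
  | |- is_word (fun G e => monoid.one) => exact: word1
  | |- is_word (fun G e => monoid.mul _ _) => apply: wordM
  | |- is_word (fun G e => monoid.inv _) => apply: wordV
  | |- is_word (fun G e => monoid.conjg _ _) => apply: wordJ
  | |- is_word (fun G e => monoid.commg _ _) => apply: wordR
  | |- is_word (fun G e => \big[_/_]_(i <- _) _) => apply: word_prod
  | |- is_word (fun G e => ?t G _) => apply: (@word_rename _ t)
  | |- is_word (fun G e => ?s ?i G _) => apply: (@word_rename _ (s i))
  end).

Ltac def_tac :=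
  repeat (cbv beta; match goal with
  | |- definable (fun G e => _ /\ _) => apply: def_and
  | |- definable (fun G e => _ \/ _) => apply: def_or
  | |- definable (fun G e => _ <-> _) => apply: def_iff
  | |- definable (fun G e => _ = _ :> _ ) => apply: def_eq; word_tac
  | |- definable (fun G e => _ <> _) => apply: def_not
  | |- definable (fun G e => exists x : _ -> _, _) => apply: def_exf
  | |- definable (fun G e => exists x, _) => apply: def_ex
  | |- definable (fun G e => _ -> _) => apply: def_imp
  | |- definable (fun G e => forall x : _ -> _, _) => apply: def_allf
  | |- definable (fun G e => forall x, _) => apply: def_all
  | |- definable _ => exact: def_const
  | |- definable (fun G e => forall x, _) => apply: def_fin => ?
  end).

Lemma def_inN t : is_word t -> definable (fun G e => inN (t G e)).
Proof. by move=> ht; rewrite /inN; def_tac. Qed.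

Lemma def_mulN u x y z : is_word u -> is_word x -> is_word y -> is_word z ->
  definable (fun G e => mulN (u G e) (x G e) (y G e) (z G e)).
Proof. by move=> hu hx hy hz; rewrite /mulN; def_tac. Qed.

(** Multiplication is only available as a graph, so a ring term denotes a
    relation. *)
Fixpoint rterm_val (G : groupType) (u : G) (e : nat -> G) (t : rterm) (x : G) : Prop :=
  match t with
  | RVar i => x = e i
  | RZero => x = 1%g
  | ROne => x = u
  | RAdd t s => exists y z, rterm_val u e t y /\ rterm_val u e s z /\ x = (y * z)%g
  | ROpp t => exists y, rterm_val u e t y /\ x = (y^-1)%g
  | RMul t s => exists y z, rterm_val u e t y /\ rterm_val u e s z /\ mulN u y z x
  end.

Definition ring_atom (G : groupType) (u : G) (e : nat -> G) (t s : rterm) : Prop :=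
  exists x, rterm_val u e t x /\ rterm_val u e s x.

(** The constant valuation [u] keeps all variables in N; the truth of a sentence
    does not depend on it. *)
Definition field_sat (G : groupType) (u : G) (phi : formula rterm) : Prop :=
  relsat (@inN G) (ring_atom u) (fun=> u) phi.

Lemma def_rterm_val t u s x :
  is_word u -> (forall j, is_word (s j)) -> is_word x ->
  definable (fun G e => rterm_val (u G e) (fun j => s j G e) t (x G e)).
Proof.
have shift k v : is_word v -> is_word (fun G e => v G (fun j => e (k + j)%N)).
  exact: word_rename.
elim: t u s x => [i||| t IHt t' IHt'|t IHt|t IHt t' IHt'] u s x hu hs hx /=;
  try by def_tac.
- apply: def_ex; apply: def_ex; apply: def_and; last apply: def_and; last by def_tac.
  + apply: (IHt (fun G e => u G _) (fun j G e => s j G _) (fun G e => e _)); word_tac.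
  + apply: (IHt' (fun G e => u G _) (fun j G e => s j G _) (fun G e => e _)); word_tac.
- apply: def_ex; apply: def_and; last by def_tac.
  apply: (IHt (fun G e => u G _) (fun j G e => s j G _) (fun G e => e _)); word_tac.
- apply: def_ex; apply: def_ex; apply: def_and; last apply: def_and.
  + apply: (IHt (fun G e => u G _) (fun j G e => s j G _) (fun G e => e _)); word_tac.
  + apply: (IHt' (fun G e => u G _) (fun j G e => s j G _) (fun G e => e _)); word_tac.
  + apply: (@def_mulN (fun G e => u G _) (fun G e => e _) (fun G e => e _) (fun G e => x G _)); word_tac.
Qed.

Lemma def_field_sat u phi : is_word u -> definable (fun G e => field_sat (u G e) phi).
Proof.
move=> hu; refine (def_relsat (dom := @inN) (atom := @ring_atom) _ _ phi (s := fun=> u) hu (fun=> hu)).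
  exact: def_inN.
move=> w s t t' hw hs; apply: def_ex; apply: def_and;
  apply: (@def_rterm_val _ (fun G e => w G _) (fun j G e => s j G _) (fun G e => e _)); word_tac.
Qed.

Section Coordinates.
Variables (G : groupType) (u : G) (K : fieldType) (psi : K -> G).
Hypothesis hpsi : coordinates u psi.

Lemma coord_inj : injective psi. Proof. by case: hpsi. Qed.
Lemma coord_N x : inN x <-> exists a, x = psi a. Proof. by case: hpsi. Qed.
Lemma coordD a b : psi (a + b) = (psi a * psi b)%g. Proof. by case: hpsi. Qed.
Lemma coord1 : psi 1 = u. Proof. by case: hpsi. Qed.
Lemma coordM a b z : mulN u (psi a) (psi b) z <-> z = psi (a * b).
Proof. by case: hpsi. Qed.

Lemma coord0 : psi 0 = 1%g.
Proof. by apply: (@mulgI _ (psi 0)); rewrite -coordD addr0 mulg1. Qed.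

Lemma coordB a : psi (- a) = ((psi a)^-1)%g.
Proof. by apply: (@mulgI _ (psi a)); rewrite -coordD subrr mulgV coord0. Qed.

Lemma coord_eq0 a : (psi a = 1)%g <-> a = 0.
Proof. by rewrite -coord0; split=> [/coord_inj|->]. Qed.

Lemma rterm_valE e t x :
  rterm_val u (fun j => psi (e j)) t x <-> x = psi (reval e t).
Proof.
elim: t x => [i||| t IHt s IHs|t IHt|t IHt s IHs] x //=.
- by rewrite coord0.
- by rewrite coord1.
- split=> [[y [z [/IHt-> [/IHs-> ->]]]]|->]; first by rewrite coordD.
  by exists (psi (reval e t)), (psi (reval e s)); rewrite IHt IHs coordD.
- split=> [[y [/IHt-> ->]]|->]; first by rewrite coordB.
  by exists (psi (reval e t)); rewrite IHt coordB.
- split=> [[y [z [/IHt-> [/IHs->]]]]|->]; first by move/coordM.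
  by exists (psi (reval e t)), (psi (reval e s)); rewrite IHt IHs coordM.
Qed.

Lemma field_satE phi e : free_vars rvars phi = [::] ->
  field_sat u phi <-> sat (@reval K) e phi.
Proof.
move=> phi0; rewrite (sat_closed (@reval_ext K) e (fun=> 1) phi0) /field_sat -{2}coord1.
apply: relsatE => [x|e' t s]; first exact: coord_N.
split=> [[x [/rterm_valE -> /rterm_valE]]|E]; first exact: coord_inj.
by exists (psi (reval e' t)); rewrite !rterm_valE E.
Qed.

End Coordinates.

Definition center_sat (G : groupType) (phi : formula gterm) : Prop :=
  relsat (fun z : G => forall g, z * g = g * z)%g
    (fun e t s => geval e t = geval e s) (fun=> 1%g) phi.

Lemma def_center_sat phi : definable (fun G e => center_sat G phi).
Proof.
refine (@def_relsat _ (fun G z => forall g, z * g = g * z)%g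
  (fun G _ e t s => geval e t = geval e s) _ _ phi
  (fun _ _ => 1%g) (fun _ _ _ => 1%g) word1 (fun=> word1)).
- by move=> t ht; def_tac.
- move=> w s t t' _ hs; apply: def_eq.
    elim: t => [i||t IHt r IHr|t IHt] /=; word_tac.
  elim: t' => [i||t' IHt r IHr|t' IHt] /=; word_tac.
Qed.

Lemma center_satE (G : groupType) phi e : free_vars gvars phi = [::] ->
  center_sat G phi <-> sat (@geval (center G)) e phi.
Proof.
move=> phi0; rewrite (sat_closed (@geval_ext _) e (fun=> 1%g) phi0).
have domE x : (forall g, x * g = g * x)%g <-> exists z : center G, x = val z.
  split=> [hx|[z ->]]; last exact/centergP/valP.
  by exists (exist (fun z => z \in @centerg G) x (introT (centergP x) hx)).
have atomE (e' : nat -> center G) t s :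
    geval (fun j => val (e' j)) t = geval (fun j => val (e' j)) s <-> geval e' t = geval e' s.
  have gevalE r : geval (fun j => val (e' j)) r = val (geval e' r).
    by elim: r => //= [r -> r' ->|r ->]; rewrite ?valM ?valV.
  by rewrite !gevalE; split=> [/val_inj|->].
exact: (relsatE domE atomE phi (fun=> 1%g)).
Qed.

Lemma transfer_sentence (P : forall G : groupType, Prop) (H G : groupType) :
  definable (fun G _ => P G) -> group_equiv H G -> P G -> P H.
Proof.
by move=> hP HG hG; exact: (definable_transfer hP HG (fun=> hG) (fun=> 1%g)).
Qed.

Lemma group_equiv_center (H G : groupType) :
  group_equiv H G -> group_equiv (center H) (center G).
Proof.
move=> HG phi phi0 eH eG; rewrite -!center_satE //.
have GH : group_equiv G H by move=> p p0 e e'; rewrite (HG p p0 e' e).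
by split; [exact: transfer_sentence (def_center_sat phi) GH
          |exact: transfer_sentence (def_center_sat phi) HG].
Qed.

(** The group sentence used quantifies over every v <> 1 in N, so that nothing
    relates the unit [u] of H to a particular element of G: it is enough that
    every choice of v interprets F in G. *)
Lemma field_equiv_of_coordinates (H G : groupType) (u : H) (L F : fieldType) (psi : L -> H) :
  group_equiv H G -> coordinates u psi ->
  (forall v : G, inN v -> v <> 1%g -> exists phi : F -> G, coordinates v phi) ->
  field_equiv L F.
Proof.
move=> HG hpsi hF.
have NuL : inN u by apply/(coord_N hpsi); exists 1; rewrite (coord1 hpsi).
have u1 : u <> 1%g.
  by rewrite -(coord1 hpsi); move/(coord_eq0 hpsi)/eqP; rewrite oner_eq0.
have FL phi eL eF : free_vars rvars phi = [::] ->
    sat (@reval F) eF phi -> sat (@reval L) eL phi.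
  move=> phi0 Fphi; apply/(field_satE hpsi eL phi0).
  move: u NuL u1 {hpsi}; pose P (K : groupType) := forall v : K, inN v -> v <> 1%g -> field_sat v phi.
  apply: (transfer_sentence (P := P) _ HG); rewrite /P.
    apply: def_all; apply: def_imp; first exact/def_inN/word_var.
    apply: def_imp; first by def_tac.
    exact: (@def_field_sat (fun G e => e 0%N) _ (word_var 0)).
  by move=> v Nv v1; have [psi' h'] := hF v Nv v1; exact/(field_satE h' eF phi0).
move=> phi phi0 eL eF; split=> [Lphi|]; last exact: FL.
apply: contrapT => nF; have := FL (FImp phi (FFalse _)) eL eF.
by rewrite /= phi0 => /(_ erefl nF); apply.
Qed.

(** * Frames *)

(** In T_n(F) the parameters are a_i = (1 + E_1i)^-1, c_j = 1 + E_jn and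
    g_i = (1 + E_ii)^-1, where n = m + 1 and indices are shifted to start at 0.
    Then c_1 = 1 + E_1n is the unit of the field on N. *)
Section Frame.
Variables (m : nat) (G : groupType) (a c g : 'I_m.+1 -> G).
Local Open Scope group_scope.

(** For x unitriangular, [~ a_i, x] is the inverse of 1 + E_1i (x - 1), which
    keeps row i of x - 1 only; the second commutator with c_j keeps its j-th
    entry, in the upper right corner.  The cases i = 1 and j = n need no separate
    treatment, because there a_i and c_j are diagonal with one entry different
    from 1, and 2 - 1 = 1. *)
Definition entry (i j : 'I_m.+1) (x : G) : G := [~ c j, [~ a i, x]].

(** The unitriangular matrices: v_i can be taken as the matrix that carries one
    row, for then v_i ^ g_i = v_i^2, so [~ v_i, g_i] = v_i. *)
Definition inU (x : G) : Prop :=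
  exists v : 'I_m.+1 -> G, x = \prod_(i < m.+1) [~ v i, g i].

(** The diagonal matrices. *)
Definition inD (t : G) : Prop := forall i, t * g i = g i * t.

(** The quotient t_i / t_n of diagonal entries, read off the root subgroup of
    position (i, n). *)
Definition ratio (t : G) (i : 'I_m.+1) : G :=
  if i == ord_max then c ord0 else entry i ord_max (c i ^ t^-1).

(** The entries take all values in N above the diagonal, determine x, and
    satisfy (xy - 1) = (x - 1) + (y - 1) + (x - 1)(y - 1). *)
Definition unipotent_frame : Prop :=
  (forall x y, inU x -> inU y -> inU (x * y)) /\
  (forall x t, inU x -> inD t -> inU (x ^ t)) /\
  (forall x, inU x -> forall i j,
     inN (entry i j x) /\ ((j <= i)%N -> entry i j x = 1)) /\
  (forall A : 'I_m.+1 * 'I_m.+1 -> G,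
     (forall i j, inN (A (i, j)) /\ ((j <= i)%N -> A (i, j) = 1)) ->
     exists x, inU x /\ forall i j, entry i j x = A (i, j)) /\
  (forall x y, inU x -> inU y -> (forall i j, entry i j x = entry i j y) -> x = y) /\
  (forall x y, inU x -> inU y -> forall i k, forall z : 'I_m.+1 -> G,
     (forall j, mulN (c ord0) (entry i j x) (entry j k y) (z j)) ->
     entry i k (x * y) = entry i k x * entry i k y * \prod_(j < m.+1) z j).

(** The ratios form a surjective morphism with central kernel from the abelian
    group D to the (n-1)-tuples of nonzero field elements, D is a complement of U, and
    t x t^-1 has entries t_i x_ij / t_j. *)
Definition diagonal_frame : Prop :=
  (forall t, inD t -> forall i, inN (ratio t i) /\ ratio t i <> 1) /\
  (forall s t, inD s -> inD t -> forall i,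
     mulN (c ord0) (ratio s i) (ratio t i) (ratio (s * t) i)) /\
  (forall A : 'I_m.+1 -> G, (forall i, inN (A i) /\ A i <> 1) ->
     exists t, inD t /\ forall i, i <> ord_max -> ratio t i = A i) /\
  (forall t, inD t -> (forall i, ratio t i = c ord0) -> forall x, t * x = x * t) /\
  (forall s t, inD s -> inD t -> s * t = t * s) /\
  (forall x, exists y t, inU y /\ inD t /\ x = y * t) /\
  (forall x, inU x -> inD x -> x = 1) /\
  (forall t x, inD t -> inU x -> forall i j, forall z,
     mulN (c ord0) (ratio t i) (entry i j x) z ->
     mulN (c ord0) (entry i j (x ^ t^-1)) (ratio t j) z).

End Frame.

Definition has_frame (m : nat) (G : groupType) : Prop :=
  exists a c g : 'I_m.+1 -> G,
    conj_field (c ord0) /\ unipotent_frame a c g /\ diagonal_frame a c g.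

Ltac frame_tac :=
  repeat (cbv beta; first [ match goal with
  | |- definable (fun G e => inN _) => apply: def_inN; word_tac
  | |- definable (fun G e => mulN _ _ _ _) => apply: def_mulN; word_tac
  | |- is_word (fun G e => if ?b then _ else _) => case: b
  end | progress word_tac | progress def_tac]).

(** Entries, products and ratios are words, and all quantifiers range over group
    elements, finite families of them, or the finite set of indices. *)
Lemma def_has_frame m : definable (fun G _ => has_frame m G).
Proof.
rewrite /has_frame /conj_field /unipotent_frame /diagonal_frame.
rewrite /inU /inD /ratio /entry; frame_tac.
Qed.

(** * Split extensions are deformations *)

Lemma group_iso_inv (G K : groupType) (f : G -> K) :
  (forall x y, f (x * y) = f x * f y)%g -> (forall x, f x = 1 -> x = 1)%g ->
  (forall y, exists x, f x = y) -> group_iso K G.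
Proof.
move=> fM f_ker /choice[h fh].
have f1 : (f 1 = 1)%g by apply: (@mulgI _ (f 1%g)); rewrite -fM !mulg1.
have fV x : (f x^-1 = (f x)^-1)%g.
  by apply: (@mulgI _ (f x)); rewrite -fM !mulgV f1.
have f_inj x y : f x = f y -> x = y.
  move=> xy; apply/eqP; rewrite -divg_eq1; apply/eqP/f_ker.
  by rewrite fM fV xy mulgV.
have hM x y : (h (x * y) = h x * h y)%g by apply: f_inj; rewrite fM !fh.
pose hm := isMultiplicative.Build K G h hM.
pose F : {multiplicative K -> G} := HB.pack h hm.
by exists F, f => // x; apply: f_inj; rewrite fh.
Qed.

(** H is generated by a copy of UT_n(L) and a set-theoretic lift [tau] of B_n(L)
    that is multiplicative up to the center and normalises the copy as B_n(L)
    does.  The central discrepancy of [tau] is the cocycle. *)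
Section DeformationOfSplitting.
Local Open Scope group_scope.
Variables (L : fieldType) (n : nat) (H : groupType).
Variables (iota : UTn L n -> H) (tau : Bn L n -> H).
Hypothesis iotaM : forall U V, iota (U * V) = iota U * iota V.
Hypothesis tau1 : tau 1 = 1.
Hypothesis tauC : forall b b', tau b * tau b' = tau b' * tau b.
Hypothesis tau_central :
  forall b b' x, (tau b * tau b' * (tau (b * b'))^-1) * x = x * (tau b * tau b' * (tau (b * b'))^-1).
Hypothesis iotaJ : forall b V, tau b * iota V = iota (Bconj b V) * tau b.
Hypothesis iota_tau_onto :
  forall x, exists V z b, (forall y, z * y = y * z) /\ x = iota V * z * tau b.
Hypothesis iota_tau_ker : forall V z b, (forall y, z * y = y * z) ->
  iota V * z * tau b = 1 -> V = 1 /\ b = 1.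

Let iota1 : iota 1 = 1.
Proof. by apply: (@mulgI _ (iota 1)); rewrite -iotaM !mulg1. Qed.

Definition splitting_cocycle (b b' : Bn L n) : center H :=
  exist (fun z => z \in @centerg H) (tau b * tau b' * (tau (b * b'))^-1)
    (introT (centergP _) (tau_central b b')).

Let f_tau b b' : val (splitting_cocycle b b') * tau (b * b') = tau b * tau b'.
Proof. by rewrite /= mulgVK. Qed.

Let fC b b' x : val (splitting_cocycle b b') * x = x * val (splitting_cocycle b b').
Proof. exact: tau_central. Qed.

Fact splitting_cocycleP : sym_cocycle_axiom splitting_cocycle.
Proof.
split=> [x y z|x|x y].
- apply: val_inj; rewrite !valM; apply: (@mulIg _ (tau (x * y * z))).
  transitivity (tau x * tau y * tau z).
    by rewrite -fC -mulgA f_tau mulgA f_tau.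
  have -> : x * y * z = x * (y * z) by rewrite mulgA.
  by rewrite -fC -[RHS]mulgA f_tau [RHS]mulgA fC -[RHS]mulgA f_tau mulgA.
- by split; apply: val_inj; rewrite /= ?mul1g ?mulg1 tau1 ?mul1g ?mulg1 mulgV.
- by apply: val_inj; rewrite /= tauC [x * y]abmulgC.
Qed.

Definition splitting_sym_cocycle : sym_cocycle (Bn L n) (center H) :=
  SymCocycle splitting_cocycleP.
Local Notation D := (Tn_deform splitting_sym_cocycle).

Definition of_deform (x : D) : H :=
  iota (tdef_uni x) * val (ext_ker (tdef_ext x)) * tau (ext_quo (tdef_ext x)).

Let central (z : center H) y : val z * y = y * val z.
Proof. exact/centergP/valP. Qed.

Lemma of_deformM x y : of_deform (x * y) = of_deform x * of_deform y.
Proof.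
case: x y => [V [z b]] [V' [z' b']].
have [F [T [FT ->]]] : exists F T, F * T = tau b * tau b' /\
    of_deform (Tdef V (Ext _ z b) * Tdef V' (Ext _ z' b')) =
    iota (V * Bconj b V') * (val z * val z' * F) * T.
  by exists (val (splitting_cocycle b b')), (tau (b * b')); split; first exact: f_tau.
rewrite iotaM -!mulgA FT /of_deform /= -!mulgA; congr (_ * _).
have cz := central z; have cz' := central z'.
rewrite -[sval z]/(val z) -[sval z']/(val z'); move: (val z) (val z') cz cz' => w w' cw cw'.
rewrite (mulgA (tau b)) iotaJ -!mulgA [RHS]mulgA [in RHS]cw -[RHS]mulgA.
by congr (_ * (_ * _)); rewrite !mulgA cw'.
Qed.

Lemma of_deform_ker x : of_deform x = 1 -> x = 1.
Proof.
case: x => [V [z b]] E; have [/= V1 b1] := iota_tau_ker (central z) E.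
move: E; rewrite {}V1 {}b1 /of_deform /= iota1 tau1 mul1g mulg1 => z1.
by congr (Tdef _ (Ext _ _ _)); apply: val_inj.
Qed.

Lemma of_deform_onto x : exists y, of_deform y = x.
Proof.
have [V [z [b [cz ->]]]] := iota_tau_onto x.
pose zc : center H := exist (fun z => z \in @centerg H) z (introT (centergP z) cz).
by exists (Tdef V (Ext splitting_sym_cocycle zc b)).
Qed.

Lemma group_iso_deform : exists f : sym_cocycle (Bn L n) (center H), group_iso H (Tn_deform f).
Proof.
exists splitting_sym_cocycle; apply: (group_iso_inv of_deformM).
  exact: of_deform_ker.
exact: of_deform_onto.
Qed.
End DeformationOfSplitting.

(** * Coordinates on the matrix groups *)

Section MatrixCoordinates.
Variables (L : fieldType) (n : nat).

Lemma upper_unitmx (A : 'M[L]_n) :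
  (forall i j : 'I_n, (j < i)%N -> A i j = 0) -> (forall i, A i i != 0) -> A \in unitmx.
Proof.
move=> A_up A_diag; rewrite unitmxE -det_tr det_trig.
  by rewrite unitfE prodf_seq_neq0; apply/allP => i _; rewrite mxE A_diag.
by apply/is_trig_mxP => i j ij; rewrite mxE A_up.
Qed.

(** The entries of V - 1, which are what the words [entry] compute. *)
Definition uni_coef (V : UTn L n) (i j : 'I_n) : L := val (val V) i j - (i == j)%:R.

Lemma uni_coef0 V (i j : 'I_n) : (j <= i)%N -> uni_coef V i j = 0.
Proof.
have /unitriP[/uppertriP V_up V_diag] := valP V.
rewrite /uni_coef leq_eqVlt => /orP[/eqP/val_inj->|ji]; first by rewrite V_diag eqxx subrr.
by rewrite V_up // -val_eqE /= gtn_eqF // subrr.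
Qed.

Lemma uni_coefM V W i k :
  uni_coef (V * W)%g i k =
  uni_coef V i k + uni_coef W i k + \sum_j uni_coef V i j * uni_coef W j k.
Proof.
pose M U : 'M[L]_n := \matrix_(i, j) uni_coef U i j.
have ME U : val (val U) = M U + 1%:M.
  by apply/matrixP => p q; rewrite !mxE subrK.
have -> : uni_coef (V * W)%g i k = (val (val V) *m val (val W) - 1%:M) i k.
  by rewrite [RHS]mxE; congr (_ + _); rewrite !mxE.
rewrite !ME mulmxDl mulmxDr mulmx1 mul1mx addrA addrK !mxE -addrA addrC; congr (_ + _).
by apply: eq_bigr => j _; rewrite !mxE.
Qed.

Lemma uni_coef_inj V W : (forall i j, uni_coef V i j = uni_coef W i j) -> V = W.
Proof.
move=> VW; apply/val_inj/val_inj/matrixP => i j.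
by apply: (addIr (- (i == j)%:R)); apply: VW.
Qed.

Lemma uni_coef_onto (A : 'I_n -> 'I_n -> L) :
  (forall i j : 'I_n, (j <= i)%N -> A i j = 0) ->
  exists V, forall i j, uni_coef V i j = A i j.
Proof.
move=> A0; pose M : 'M[L]_n := \matrix_(i, j) (A i j + (i == j)%:R).
have M_up (i j : 'I_n) : (j < i)%N -> M i j = 0.
  by move=> ji; rewrite mxE A0 ?(ltnW ji) // -val_eqE /= gtn_eqF // addr0.
have M_diag i : M i i = 1 by rewrite mxE A0 // eqxx add0r.
have M_unit : M \in unitmx by apply: upper_unitmx => // i; rewrite M_diag oner_neq0.
pose V0 : GLn L n := exist (fun A : 'M[L]_n => A \in unitmx) M M_unit.
have V0_uni : V0 \in @unitri L n by apply/unitriP; split=> //; apply/uppertriP.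
exists (exist (fun A => A \in @unitri L n) V0 V0_uni) => i j.
by rewrite /uni_coef /= mxE addrK.
Qed.

Definition diag_coef (b : Bn L n) (i : 'I_n) : L := val (val b) i i.

Lemma Bn_diag (b : Bn L n) : val (val b) = diag_mx (\row_i diag_coef b i).
Proof.
have /asboolP[d bd] := valP b; apply/matrixP => i j; rewrite !mxE.
have [->|ij] := eqVneq i j; first by rewrite mulr1n.
by rewrite bd val_prod_dGL !mxE (negPf ij).
Qed.

Lemma diag_coefM b b' i : diag_coef (b * b')%g i = diag_coef b i * diag_coef b' i.
Proof.
rewrite /diag_coef; change ((val (val b) *m val (val b')) i i = diag_coef b i * diag_coef b' i).
by rewrite !Bn_diag mulmx_diag !mxE eqxx.
Qed.

Lemma diag_coef_inj b b' : (forall i, diag_coef b i = diag_coef b' i) -> b = b'.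
Proof.
move=> bb; apply/val_inj/val_inj; rewrite !Bn_diag; congr diag_mx.
by apply/rowP => i; rewrite !mxE.
Qed.

Lemma diag_coef1 i : diag_coef 1%g i = 1.
Proof. by rewrite /diag_coef mxE eqxx. Qed.

Lemma diag_coef_neq0 b i : diag_coef b i != 0.
Proof.
have := oner_neq0 L; rewrite -(diag_coef1 i) -(mulgV b) diag_coefM.
by rewrite mulf_eq0 negb_or => /andP[].
Qed.

Lemma diag_coef_last b (i : 'I_n) : ~~ (i.+1 < n)%N -> diag_coef b i = 1.
Proof.
move=> i_last; have /asboolP[d bd] := valP b.
by rewrite /diag_coef bd val_prod_dGL !mxE eqxx (negPf i_last).
Qed.

Lemma diag_coef_onto (d : 'I_n -> L) :
  (forall i, d i != 0) -> (forall i : 'I_n, ~~ (i.+1 < n)%N -> d i = 1) ->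
  exists b, forall i, diag_coef b i = d i.
Proof.
move=> d0 d1; pose u i : units L := exist (fun x : L => x != 0) (d i) (d0 i).
pose b0 : GLn L n := (\prod_(i < n | (i.+1 < n)%N) dGL i (u i))%g.
have b0P : b0 \in @bdiag L n by apply/asboolP; exists u.
exists (exist (fun A => A \in @bdiag L n) b0 b0P) => i.
change (val b0 i i = d i); rewrite val_prod_dGL !mxE eqxx mulr1n.
by case: ifP => // /negbT /d1.
Qed.

Lemma uni_coef_conj b V i j :
  uni_coef (Bconj b V) i j * diag_coef b j = diag_coef b i * uni_coef V i j.
Proof.
have E : val (val (Bconj b V)) *m val (val b) = val (val b) *m val (val V).
  by rewrite -!GLn_valM val_Bconj mulgVK.
move: (Bconj b V) E => W E; have := congr1 (fun M : 'M_n => M i j) E.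
rewrite [val (val b)]Bn_diag mul_mx_diag mul_diag_mx !mxE => Eij.
by rewrite /uni_coef mulrBl mulrBr Eij; case: eqP => [->|_]; rewrite ?mulr1 ?mul1r // mulr0 mul0r.
Qed.

End MatrixCoordinates.

(** * A group with a frame is a deformation *)

Section FrameIsomorphism.
Local Open Scope group_scope.
Variables (m : nat) (H : groupType) (a c g : 'I_m.+1 -> H).
Variables (L : fieldType) (psi : L -> H).
Hypothesis hpsi : coordinates (c ord0) psi.
Hypothesis frame_uni : unipotent_frame a c g.
Hypothesis frame_diag : diagonal_frame a c g.

Local Notation n := m.+1.

Lemma inD1 : inD g 1. Proof. by move=> i; rewrite mulg1 mul1g. Qed.

Lemma inDM s t : inD g s -> inD g t -> inD g (s * t).
Proof. by move=> Ds Dt i; rewrite -mulgA Dt mulgA Ds mulgA. Qed.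

Lemma inDV t : inD g t -> inD g t^-1.
Proof.
move=> Dt i; have := commuteV (esym (Dt i) : commute (g i) t).
by move=> /esym.
Qed.

Lemma inD_central z : (forall x, z * x = x * z) -> inD g z.
Proof. by move=> cz i. Qed.

Lemma exists_iota : exists iota : UTn L n -> H, forall V,
  inU g (iota V) /\ forall i j, entry a c i j (iota V) = psi (uni_coef V i j).
Proof.
suff /choice[iota iotaP] : forall V : UTn L n, exists x,
    inU g x /\ forall i j, entry a c i j x = psi (uni_coef V i j).
  by exists iota.
move=> V; have [_ [_ [_ [onto _]]]] := frame_uni.
have [|x [Ux xE]] := onto (fun ij => psi (uni_coef V ij.1 ij.2)); last by exists x.
move=> i j /=; split; first by apply/(coord_N hpsi); exists (uni_coef V i j).
by move=> ji; rewrite uni_coef0 // (coord0 hpsi).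
Qed.

Lemma entry_coef x : inU g x ->
  exists V : UTn L n, forall i j, entry a c i j x = psi (uni_coef V i j).
Proof.
have [_ [_ [entries _]]] := frame_uni; move=> Ux.
have /choice[A xA] : forall ij : 'I_n * 'I_n, exists k, entry a c ij.1 ij.2 x = psi k.
  by move=> ij; apply/(coord_N hpsi); case: (entries x Ux ij.1 ij.2).
have [i j ji|V VA] := uni_coef_onto (A := fun i j => A (i, j)).
  by apply/(coord_eq0 hpsi); rewrite -xA; case: (entries x Ux i j) => _; apply.
by exists V => i j; rewrite VA -xA.
Qed.

Lemma ratio_neq0 t i : inD g t -> exists2 r, r != 0%R & ratio a c t i = psi r.
Proof.
have [ratios _] := frame_diag; move=> Dt.
have [/(coord_N hpsi)[r rE] r1] := ratios t Dt i.
exists r => //; apply/eqP => r0; case: r1; rewrite rE.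
by apply/(coord_eq0 hpsi).
Qed.

Lemma ratioM s t i x y : inD g s -> inD g t ->
  ratio a c s i = psi x -> ratio a c t i = psi y -> ratio a c (s * t) i = psi (x * y)%R.
Proof.
have [_ [mul _]] := frame_diag; move=> Ds Dt sx ty.
by have := mul s t Ds Dt i; rewrite sx ty => /(coordM hpsi).
Qed.

Lemma ratio1 i : ratio a c 1 i = psi 1%R.
Proof.
have [r r0 rE] := ratio_neq0 i inD1; have := ratioM inD1 inD1 rE rE.
rewrite mulg1 rE => /(coord_inj hpsi) rr; congr psi.
by apply: (mulfI r0); rewrite mulr1 -rr.
Qed.

Lemma ratio_central z i : (forall x, z * x = x * z) -> ratio a c z i = psi 1%R.
Proof.
move=> cz; rewrite -(ratio1 i) /ratio invg1 conjg1 conjgE invgK.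
by rewrite mulgA cz mulgK.
Qed.

Lemma ratioV t i x : inD g t -> ratio a c t i = psi x -> ratio a c t^-1 i = psi x^-1%R.
Proof.
move=> Dt tx; have [r r0 rE] := ratio_neq0 i (inDV Dt).
have := ratioM Dt (inDV Dt) tx rE; rewrite mulgV ratio1 rE => /(coord_inj hpsi) xr.
have x0 : x != 0%R.
  by apply/eqP => x0; move/eqP: xr; rewrite x0 mul0r oner_eq0.
by congr psi; apply: (mulfI x0); rewrite -xr divff.
Qed.

(** The lift is normalised at 1, as required of cocycles. *)
Lemma exists_tau : exists tau : Bn L n -> H,
  [/\ tau 1 = 1, forall b, inD g (tau b)
    & forall b i, ratio a c (tau b) i = psi (diag_coef b i)].
Proof.
have [_ [_ [onto _]]] := frame_diag.
suff /choice[tau tauP] : forall b : Bn L n, exists t, (b = 1 -> t = 1) /\ inD g t /\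
    forall i, ratio a c t i = psi (diag_coef b i).
  exists tau; split=> [|b|b i]; [by case: (tauP 1) => ->|by case: (tauP b) => _ []|].
  by case: (tauP b) => _ [].
move=> b; have [->|b1] := EM (b = 1).
  by exists 1; split=> //; split=> [|i]; [exact: inD1|rewrite ratio1 diag_coef1].
have [i|t [Dt tE]] := onto (fun i => psi (diag_coef b i)).
  split; first by apply/(coord_N hpsi); exists (diag_coef b i).
  by move/(coord_eq0 hpsi)/eqP; rewrite (negPf (diag_coef_neq0 b i)).
exists t; split=> //; split=> // i; have [->|/eqP i_max] := eqVneq i ord_max; last exact: tE.
by rewrite /ratio eqxx diag_coef_last ?ltnn // (coord1 hpsi).
Qed.

(** All hypotheses on [iota] and [tau] are checked on entries and ratios, where
    they become identities between matrix coefficients over L; an element of D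
    all of whose ratios are 1 is central, which gives the cocycle. *)
Lemma group_iso_of_frame :
  exists f : sym_cocycle (Bn L n) (center H), group_iso H (Tn_deform f).
Proof.
have [iota iotaP] := exists_iota; have [tau [tau1 tauD tauE]] := exists_tau.
have [UM [UJ [_ [_ [entry_inj entryM]]]]] := frame_uni.
have [_ [_ [_ [ratio_ker [DC [decomp [UD entryJ]]]]]]] := frame_diag.
have iotaU V : inU g (iota V) by case: (iotaP V).
have iotaE V i j : entry a c i j (iota V) = psi (uni_coef V i j) by case: (iotaP V).
have iota_inj : injective iota.
  by move=> V W VW; apply: uni_coef_inj => i j; apply: (coord_inj hpsi); rewrite -!iotaE VW.
have psi_sum (F : 'I_n -> L) : \prod_(j < n) psi (F j) = psi (\sum_j F j)%R.
  by rewrite (big_morph psi (coordD hpsi) (coord0 hpsi)).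
have iotaM V W : iota (V * W) = iota V * iota W.
  apply: entry_inj => [//||i k]; first exact: UM.
  rewrite (entryM _ _ (iotaU V) (iotaU W) i k (fun j => psi (uni_coef V i j * uni_coef W j k)%R)).
    by rewrite !iotaE uni_coefM psi_sum !(coordD hpsi).
  by move=> j; rewrite !iotaE; apply/(coordM hpsi).
have iota1 : iota 1 = 1 by apply: (@mulgI _ (iota 1)); rewrite -iotaM !mulg1.
have ratio1_central t : inD g t -> (forall i, ratio a c t i = psi 1%R) -> forall x, t * x = x * t.
  by move=> Dt tE; apply: ratio_ker => // i; rewrite tE (coord1 hpsi).
apply: (group_iso_deform (iota := iota) (tau := tau)) => //.
- by move=> b b'; apply: DC.
- move=> b b'; have Dbb := inDM (tauD b) (tauD b').
  apply: ratio1_central => [|i]; first exact: inDM Dbb (inDV (tauD _)).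
  rewrite (ratioM Dbb (inDV (tauD _)) (ratioM (tauD b) (tauD b') (tauE b i) (tauE b' i))
    (ratioV (tauD _) (tauE _ i))).
  by rewrite -diag_coefM divff ?diag_coef_neq0.
- move=> b V; suff <- : iota V ^ (tau b)^-1 = iota (Bconj b V) by rewrite conjgE invgK -mulgA mulgVK.
  have UJV : inU g (iota V ^ (tau b)^-1) by apply: UJ => //; apply: inDV.
  apply: entry_inj => // i j; have [W WE] := entry_coef UJV.
  have := iffRL (coordM hpsi (diag_coef b i) (uni_coef V i j) _) erefl.
  rewrite -tauE -iotaE => /(entryJ (tau b) (iota V) (tauD b) (iotaU V)).
  rewrite WE tauE iotaE => /(coordM hpsi)/(coord_inj hpsi); rewrite -uni_coef_conj.
  by move/(mulIf (diag_coef_neq0 b j)) ->.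
- move=> x; have [y [t [Uy [Dt ->]]]] := decomp x.
  have [V VE] := entry_coef Uy.
  have yV : y = iota V by apply: entry_inj => // i j; rewrite VE iotaE.
  have /choice[d dP] : forall i, exists r, r != 0%R /\ ratio a c t i = psi r.
    by move=> i; have [r r0 rE] := ratio_neq0 i Dt; exists r.
  have [i|i i_max|b bE] := @diag_coef_onto L n d; first by case: (dP i).
    apply: (coord_inj hpsi); rewrite -(dP i).2 /ratio (coord1 hpsi) ifT // -val_eqE /=.
    by rewrite eqn_leq -ltnS ltn_ord leqNgt.
  exists V, (t * (tau b)^-1), b; split; last by rewrite yV -mulgA mulgVK.
  apply: ratio1_central => [|i]; first exact: inDM Dt (inDV (tauD b)).
  rewrite (ratioM Dt (inDV (tauD b)) (dP i).2 (ratioV (tauD b) (tauE b i))).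
  by rewrite bE divff ?(dP i).1.
- move=> V z b cz E.
  have Dz := inD_central cz.
  have V1 : iota V = 1.
    apply: UD => //; have -> : iota V = (z * tau b)^-1.
      by apply: (@mulIg _ (z * tau b)); rewrite mulgA E mulVg.
    exact: inDV (inDM Dz (tauD b)).
  split; first by apply: iota_inj; rewrite V1 iota1.
  apply: diag_coef_inj => i; apply: (coord_inj hpsi); rewrite -tauE diag_coef1.
  have -> : tau b = z^-1.
    by apply: (@mulgI _ z); rewrite mulgV -E V1 mul1g.
  by rewrite (ratioV Dz (ratio_central i cz)) invr1.
Qed.

End FrameIsomorphism.

(** * The frame of T_n(F) *)

Section Triangular.
Variables (F : fieldType) (m : nat).
Local Notation n := m.+1.
Local Notation T := (Tn F n).
Local Notation D := delta_mx.

Definition tmx (x : T) : 'M[F]_n := val (val x).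

Lemma tmxM x y : tmx (x * y)%g = tmx x *m tmx y. Proof. by []. Qed.
Lemma tmx1 : tmx 1%g = 1%:M. Proof. by []. Qed.
Lemma tmx_inj : injective tmx. Proof. by move=> x y xy; apply/val_inj/val_inj. Qed.

Lemma tmx_upper x (i j : 'I_n) : (j < i)%N -> tmx x i j = 0.
Proof. by move: i j; apply/uppertriP/(valP x). Qed.

Lemma tmx_diag_neq0 x i : tmx x i i != 0.
Proof. exact/uppertri_diag/(valP x). Qed.

Lemma tmx_diagM x y i : tmx (x * y)%g i i = tmx x i i * tmx y i i.
Proof. by have := uppertri_mulE (valP x) (valP y) (leqnn i); rewrite eqxx. Qed.

Lemma tmx_onto (A : 'M[F]_n) :
  (forall i j : 'I_n, (j < i)%N -> A i j = 0) -> (forall i, A i i != 0) ->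
  exists x, tmx x = A.
Proof.
move=> A_up A_diag.
pose x0 : GLn F n := exist (fun A : 'M[F]_n => A \in unitmx) A (upper_unitmx A_up A_diag).
have x0P : x0 \in @uppertri F n by apply/uppertriP.
by exists (exist (fun A => A \in @uppertri F n) x0 x0P).
Qed.

Lemma tmx_elementary (i j : 'I_n) k : (i <= j)%N -> (i == j)%:R * k != -1 ->
  exists x, tmx x = 1%:M + k *: D i j.
Proof.
move=> ij k1; apply: tmx_onto => [p q qp|p]; rewrite !mxE.
  rewrite -val_eqE /= gtn_eqF // add0r; case: eqP => [pi|_]; last by rewrite mulr0.
  case: eqP => [qj|_]; last by rewrite mulr0.
  by move: qp; rewrite pi qj ltnNge ij.
rewrite eqxx addrC; have [->|_] := eqVneq p i; last by rewrite mulr0 add0r oner_neq0.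
by rewrite /= mulrC addr_eq0.
Qed.

Lemma mul_mx_delta (A : 'M[F]_n) (i j p q : 'I_n) : (A *m D i j) p q = A p i *+ (q == j).
Proof.
rewrite mxE (bigD1 i) //= big1 ?addr0 => [|k ki]; last by rewrite mxE (negPf ki) mulr0.
by rewrite mxE eqxx /= mulr_natr.
Qed.

Lemma mul_delta_mx_row (A : 'M[F]_n) (i j p q : 'I_n) : (D i j *m A) p q = A j q *+ (p == i).
Proof.
rewrite mxE (bigD1 j) //= big1 ?addr0 => [|k kj]; last by rewrite mxE (negPf kj) andbF mul0r.
by rewrite mxE eqxx andbT mulr_natl.
Qed.

Definition unipotent (x : T) := forall i, tmx x i i = 1.

Lemma unipotentM x y : unipotent x -> unipotent y -> unipotent (x * y)%g.
Proof. by move=> hx hy i; rewrite tmx_diagM hx hy mulr1. Qed.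

Lemma tmx_diagV x i : tmx (x^-1)%g i i = (tmx x i i)^-1.
Proof.
apply: (mulfI (tmx_diag_neq0 x i)); rewrite -tmx_diagM mulgV tmx1 mxE eqxx.
by rewrite divff ?tmx_diag_neq0.
Qed.

Lemma unipotentV x : unipotent x -> unipotent (x^-1)%g.
Proof. by move=> hx i; rewrite tmx_diagV hx invr1. Qed.

Lemma unipotentJ x t : unipotent x -> unipotent (x ^ t)%g.
Proof.
by move=> hx i; rewrite !tmx_diagM tmx_diagV hx mul1r mulVf ?tmx_diag_neq0.
Qed.

Lemma unipotentR x y : unipotent [~ x, y]%g.
Proof.
move=> i; rewrite !tmx_diagM !tmx_diagV [X in _ * X]mulrCA.
by rewrite mulVf ?mulr1 ?mulVf ?tmx_diag_neq0.
Qed.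

Section Frame.
Hypothesis m_ge2 : (1 < m)%N.
Variables (E : F -> T) (alpha c gamma : 'I_n -> T).
Hypothesis tmxE : forall k, tmx (E k) = 1%:M + k *: D ord0 ord_max.
Hypothesis tmx_alpha : forall i, tmx (alpha i) = 1%:M + D ord0 i.
Hypothesis tmx_c : forall i, tmx (c i) = 1%:M + D i ord_max.
Hypothesis tmx_gamma : forall i, tmx (gamma i) = 1%:M + D i i.
Let a i : T := ((alpha i)^-1)%g.
Let g i : T := ((gamma i)^-1)%g.

Let ord0_max : (ord_max == ord0 :> 'I_n) = false.
Proof. by rewrite -val_eqE /= gtn_eqF // ltnW. Qed.

(** The two matrix identities x (1 + E_1i (x - 1)) (1 + E_1i) = (1 + E_1i) x and
    (1 + R) c_j = c_j (1 + k E_1n) (1 + R), with R = E_1i (x - 1) and k the entry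
    of x - 1, evaluate the commutators without computing an inverse. *)
Lemma entryE i j x : unipotent x -> entry a c i j x = E (tmx x i j - (i == j)%:R).
Proof.
move=> hx; set X := tmx x; set k := _ - _.
have XD : X *m D ord0 i = D ord0 i.
  apply/matrixP => p q; rewrite mul_mx_delta !mxE.
  have [->|p0] := eqVneq p ord0; first by rewrite /X hx.
  by rewrite /X tmx_upper ?mul0rn // lt0n.
have [y yE] : exists y, tmx y = 1%:M + D ord0 i *m (X - 1%:M).
  apply: tmx_onto => [p q qp|p]; rewrite mxE mul_delta_mx_row.
    rewrite mxE -val_eqE /= gtn_eqF // add0r.
    by have [p0|] := eqVneq p ord0; rewrite // p0 in qp.
  rewrite mxE eqxx; have [->|_] := eqVneq p ord0; last by rewrite addr0 oner_neq0.
  rewrite !mxE; have [->|i0] := eqVneq i ord0; first by rewrite /X hx subrr mul0rn addr0 oner_neq0.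
  by rewrite /X tmx_upper ?lt0n // subr0 mul0rn addr0 oner_neq0.
have y_comm : [~ x, a i]%g = y.
  rewrite /a commgEl conjgE invgK.
  apply: (@mulgI _ x); rewrite mulVKg; apply: (@mulIg _ (alpha i)); rewrite mulgA mulgVK.
  apply: tmx_inj; rewrite !tmxM yE tmx_alpha -/X mulmxDl mul1mx.
  rewrite [X *m (1%:M + _)]mulmxDr mulmx1 mulmxA XD mulmxDr mulmx1 mulmxDl XD.
  by rewrite -mulmxA (mulmxBl X) XD mul1mx subrr mulmx0 addr0 mulmxBr mulmx1 -addrA subrK.
rewrite /entry -[[~ a i, x]%g]invgK invgR y_comm commgEl conjgE invgK.
apply: (@mulgI _ (c j)); rewrite mulVKg; apply: (@mulIg _ y).
rewrite !mulgA mulgVK; apply: tmx_inj; rewrite !tmxM yE tmx_c tmxE.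
set R := D ord0 i *m _; set Q := D j _; set S := k *: _.
have QD (l : 'I_n) : Q *m D ord0 l = 0.
  by rewrite /Q mul_delta_mx_cond ord0_max.
have QR : Q *m R = 0 by rewrite /R mulmxA QD mul0mx.
have QS : Q *m S = 0 by rewrite /S -scalemxAr QD scaler0.
have SR : S *m R = 0.
  by rewrite /S /R -scalemxAl mulmxA mul_delta_mx_cond ord0_max mul0mx scaler0.
have RQ : R *m Q = S.
  apply/matrixP => p q; rewrite mul_mx_delta /R mul_delta_mx_row !mxE /k /X.
  by case: (p == ord0); case: (q == ord_max); rewrite ?mulr1 ?mulr0 // mulr0n.
have -> : (1%:M + Q) *m (1%:M + S) = 1%:M + Q + S.
  by rewrite mulmxDr mulmx1 mulmxDl mul1mx QS addr0.
rewrite [LHS]mulmxDr mulmx1 mulmxDl mul1mx RQ mulmxDr mulmx1 !mulmxDl mul1mx QR SR !addr0.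
by rewrite -!addrA; congr (_ + _); rewrite addrC -addrA.
Qed.

Lemma E_inj : injective E.
Proof.
move=> k l /(congr1 tmx)/(congr1 (fun A : 'M_n => A ord0 ord_max)).
by rewrite !tmxE !mxE !eqxx !mulr1 => /addrI.
Qed.

Lemma ED k l : E (k + l) = (E k * E l)%g.
Proof.
apply: tmx_inj; rewrite tmxM !tmxE mulmxDr mulmx1 mulmxDl mul1mx -scalemxAl -scalemxAr.
by rewrite mul_delta_mx_cond ord0_max !scaler0 addr0 scalerDl addrA addrAC.
Qed.

(** T_n(F) acts on the corner through all scalars, which makes it a field. *)
Lemma EJ k t : (E k ^ t)%g = E (k * (tmx t ord_max ord_max / tmx t ord0 ord0)).
Proof.
apply: (@mulgI _ t); rewrite conjgE mulVKg; apply: tmx_inj; rewrite !tmxM !tmxE.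
rewrite mulmxDl mulmxDr mul1mx mulmx1; congr (_ + _).
rewrite -scalemxAl -scalemxAr; apply/matrixP => p q.
rewrite mxE mul_delta_mx_row [RHS]mxE mul_mx_delta.
have [->|p0] := eqVneq p ord0; last first.
  by rewrite (@tmx_upper t p ord0) ?lt0n // mul0rn mulr0n !mulr0.
have [->|qm] := eqVneq q ord_max.
  by rewrite -mulrA mulrVK ?unitfE ?tmx_diag_neq0 // divfK ?tmx_diag_neq0.
rewrite (@tmx_upper t ord_max q) ?mulr0n ?mulr0 //= ltn_neqAle -ltnS ltn_ord andbT.
by move: qm; rewrite -val_eqE.
Qed.

(** Indeed v ^ g_i = 1 + 2S = (1 + S)^2 = v^2. *)
Lemma commg_gamma i v S : tmx v = 1%:M + S ->
  S *m S = 0 -> S *m D i i = 0 -> D i i *m S = S -> [~ v, g i]%g = v.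
Proof.
move=> vE SS SG GS; rewrite /g commgEl conjgE invgK; apply: (@mulgI _ v); rewrite mulVKg.
apply: (@mulIg _ (gamma i)); rewrite !mulgA mulgVK; apply: tmx_inj.
rewrite !tmxM vE tmx_gamma.
have -> : (1%:M + S) *m (1%:M + S) = 1%:M + S + S.
  by rewrite mulmxDr mulmx1 mulmxDl mul1mx SS addr0.
rewrite mulmxDr mulmx1 mulmxDl mul1mx GS mulmxDr mulmx1 !mulmxDl mul1mx SG !addr0.
by rewrite -!addrA; congr (_ + _); rewrite addrC -addrA.
Qed.

(** A unitriangular w commuting with all 1 + E_ij (i < j), which are commutators,
    commutes with all E_ij; comparing entries leaves the upper right corner
    only. *)
Lemma inN_E x : inN x <-> exists k, x = E k.
Proof.
split=> [[[y [z ->]] xN]|[k ->]].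
  move: [~ y, z]%g (unipotentR y z) xN => w hw xN.
  have w_comm (i j : 'I_n) : (i < j)%N -> tmx w *m D i j = D i j *m tmx w.
    move=> ij; have [|v vE] := @tmx_elementary i j 1 (ltnW ij).
      by rewrite -val_eqE /= ltn_eqF // mul0r eq_sym oppr_eq0 oner_neq0.
    have v_comm : [~ v, g i]%g = v.
      apply: (commg_gamma (S := D i j)); rewrite ?vE ?scale1r ?mul_delta_mx //;
        by rewrite mul_delta_mx_cond -val_eqE /= gtn_eqF.
    have /(congr1 tmx) := xN v (g i); rewrite v_comm !tmxM vE scale1r.
    by rewrite mulmxDr mulmxDl mulmx1 mul1mx => /addrI.
  exists (tmx w ord0 ord_max); apply: tmx_inj; rewrite tmxE; apply/matrixP => p q.
  rewrite !mxE; have [<-|pq] := eqVneq p q.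
    rewrite hw; have [->|] := eqVneq p ord0; last by rewrite mulr0 addr0.
    by rewrite eq_sym ord0_max mulr0 addr0.
  rewrite add0r; have [p0|p0] := eqVneq p ord0; last first.
    have p_gt0 : ((ord0 : 'I_n) < p)%N by rewrite lt0n.
    have := congr1 (fun A : 'M_n => A ord0 q) (w_comm ord0 p p_gt0).
    by rewrite mul_mx_delta mul_delta_mx_row eqxx mulr0 eq_sym (negPf pq) mulr0n.
  have [->|qm] := eqVneq q ord_max; first by rewrite p0 mulr1.
  have q_lt : (q < (ord_max : 'I_n))%N.
    by rewrite /= ltn_neqAle -ltnS ltn_ord andbT; move: qm; rewrite -val_eqE.
  have := congr1 (fun A : 'M_n => A ord0 ord_max) (w_comm q ord_max q_lt).
  by rewrite mul_mx_delta mul_delta_mx_row eqxx mulr1n mulr0 p0 -p0 (negPf pq) p0.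
have Ek_comm : [~ E k, g ord0]%g = E k.
  apply: (commg_gamma (S := k *: D ord0 ord_max)) => //.
  - by rewrite -scalemxAl -scalemxAr mul_delta_mx_cond ord0_max !scaler0.
  - by rewrite -scalemxAl mul_delta_mx_cond ord0_max !scaler0.
  - by rewrite -scalemxAr mul_delta_mx.
split=> [|y z]; first by exists (E k), (g ord0).
apply: (@mulgI _ [~ y, z]^-1%g); rewrite mulKg -[LHS]/(E k ^ [~ y, z])%g EJ.
by rewrite !unipotentR divr1 mulr1.
Qed.

Lemma E_0 : E 0 = 1%g.
Proof. by apply: tmx_inj; rewrite tmxE scale0r addr0. Qed.

Lemma exists_diag (d : 'I_n -> F) : (forall i, d i != 0) ->
  exists t, forall i j, tmx t i j = d i *+ (i == j).
Proof.
move=> d0; have [i j ji|i|t tE] := @tmx_onto (diag_mx (\row_i d i)).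
- by rewrite !mxE -val_eqE /= gtn_eqF.
- by rewrite !mxE eqxx mulr1n d0.
by exists t => i j; rewrite tE !mxE.
Qed.

Lemma EJ_onto k l : k != 0 -> l != 0 -> exists t, (E k ^ t)%g = E l.
Proof.
move=> k0 l0.
have [i|t tE] := exists_diag (d := fun i => if i == ord0 then k else l); first by case: ifP.
by exists t; rewrite EJ !tE !eqxx ord0_max mulr1n mulrCA divff ?mulr1.
Qed.

Lemma conj_field_E k : k != 0 -> conj_field (E k).
Proof.
move=> k0; split; first by apply/inN_E; exists k.
split; first by rewrite -E_0 => /E_inj/eqP; rewrite (negPf k0).
split=> [x y /inN_E[p ->] /inN_E[q ->]|x y /inN_E[p ->] p1 /inN_E[q ->] q1].
  by apply/inN_E; exists (p + q); rewrite ED.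
by apply: EJ_onto; [apply: contra_not_neq p1 => ->|apply: contra_not_neq q1 => ->]; rewrite E_0.
Qed.

(** Any nontrivial element of N may serve as unit, up to rescaling. *)
Lemma coordinates_E k : k != 0 -> coordinates (E k) (fun b => E (b * k)).
Proof.
move=> k0; split.
- by move=> p q /E_inj /(mulIf k0).
- move=> x; rewrite inN_E; split=> -[p ->]; last by exists (p * k).
  by exists (p / k); rewrite divfK.
- by move=> p q; rewrite mulrDl ED.
- by rewrite mul1r.
move=> p q z; split=> [[[p1 ->]|[t [tp <-]]]|->].
- have -> : p = 0 by apply: (mulIf k0); apply: E_inj; rewrite p1 mul0r E_0.
  by rewrite !mul0r E_0.
- move: tp; rewrite !EJ => /E_inj; rewrite mulrC => /(mulIf k0) ->.
  by rewrite mulrC mulrA.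
have [->|p0] := eqVneq p 0; first by left; rewrite !mul0r E_0.
right; have [t tE] := EJ_onto k0 (mulf_neq0 p0 k0); exists t; split=> //.
move: tE; rewrite !EJ mulrC => /E_inj /(mulIf k0) ->.
by rewrite mulrC mulrA.
Qed.

Lemma coordinates_c : coordinates (c ord0) E.
Proof.
have -> : c ord0 = E 1 by apply: tmx_inj; rewrite tmx_c tmxE scale1r.
have := coordinates_E (oner_neq0 F); rewrite (_ : (fun b => E (b * 1)) = E) //.
by apply/funext => b; rewrite mulr1.
Qed.

(** Rows are split off from the right: if the rows of x from k + 1 on are
    trivial, then x = x' (1 + E_kk (x - 1)) and x' has one more trivial row. *)
Lemma unipotent_prod k x : (k <= n)%N -> unipotent x ->
  (forall i j : 'I_n, (k <= i)%N -> tmx x i j = (i == j)%:R) ->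
  exists v : nat -> T, x = (\prod_(i < k) [~ v i, g (inord i)])%g.
Proof.
elim: k x => [|k IHk] x kn hx x_rows.
  exists (fun=> 1%g); rewrite big_ord0; apply: tmx_inj; apply/matrixP => i j.
  by rewrite x_rows // tmx1 mxE.
pose i0 : 'I_n := Ordinal kn; set X := tmx x in hx x_rows.
pose S := D i0 i0 *m (X - 1%:M).
have SE p q : S p q = (X i0 q - (i0 == q)%:R) *+ (p == i0).
  by rewrite mul_delta_mx_row !mxE.
have SD : S *m D i0 i0 = 0.
  by apply/matrixP => p q; rewrite mul_mx_delta SE hx eqxx subrr mul0rn mul0rn mxE.
have SS : S *m S = 0 by rewrite {2}/S mulmxA SD mul0mx.
have [p q qp|p|r rE] := @tmx_onto (1%:M + S).
- rewrite mxE SE mxE -val_eqE /= gtn_eqF // add0r.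
  have [p0|] := eqVneq p i0; last by rewrite mulr0n.
  by rewrite -p0 /X tmx_upper // -val_eqE /= gtn_eqF // subrr mul0rn.
- rewrite mxE SE mxE eqxx; have [->|_] := eqVneq p i0; last by rewrite mulr0n addr0 oner_neq0.
  by rewrite hx ?eqxx subrr mul0rn addr0 oner_neq0.
have r_comm : [~ r, g i0]%g = r.
  by apply: (commg_gamma (S := S)) => //; rewrite /S mulmxA mul_delta_mx.
have hr : unipotent r by rewrite -r_comm; apply: unipotentR.
have rVE : tmx (r^-1)%g = 1%:M - S.
  have E1 : tmx r *m (1%:M - S) = 1%:M.
    by rewrite rE mulmxBr mulmx1 mulmxDl mul1mx SS addr0 addrK.
  transitivity (tmx (r^-1)%g *m (tmx r *m (1%:M - S))); first by rewrite E1 mulmx1.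
  by rewrite mulmxA -tmxM mulVg tmx1 mul1mx.
have [i j ki|v vE] := IHk (x * r^-1)%g (ltnW kn) (unipotentM hx (unipotentV hr)).
  rewrite tmxM rVE mulmxBr mulmx1 -/X !mxE (bigD1 i0) //= big1 ?addr0 => [|l li].
    rewrite SE eqxx mulr1n; have [->|ii0] := eqVneq i i0.
      by rewrite hx mul1r opprB addrCA subrr addr0.
    have k_lt_i : (k < i)%N by rewrite ltn_neqAle ki andbT; move: ii0; rewrite -val_eqE eq_sym.
    by rewrite (x_rows i j) // (x_rows i i0) // (negPf ii0) mul0r subr0.
  by rewrite SE (negPf li) mulr0n mulr0.
exists (fun i => if i == k then r else v i); rewrite big_ord_recr /= eqxx.
have -> : inord k = i0 by apply: val_inj; rewrite /= inordK.
rewrite r_comm -[x in LHS](mulgVK r) vE; congr (_ * _)%g.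
by apply: eq_bigr => i _; rewrite ltn_eqF.
Qed.

Lemma inUE x : inU g x <-> unipotent x.
Proof.
split=> [[v ->]|hx].
  apply: (big_ind unipotent) => [i|y z|i _]; last exact: unipotentR.
    by rewrite tmx1 mxE eqxx.
  exact: unipotentM.
have [//|//|i j|v vE] := @unipotent_prod n x; first by rewrite leqNgt ltn_ord.
exists (fun i => v i); rewrite vE; apply: eq_bigr => i _; by rewrite inord_val.
Qed.

Lemma inDE t : inD g t <-> forall i j, i != j -> tmx t i j = 0.
Proof.
have gammaC i : (t * g i = g i * t)%g <-> tmx t *m D i i = D i i *m tmx t.
  transitivity (t * gamma i = gamma i * t)%g.
    split=> h; last by rewrite /g; apply: commuteV.
    by rewrite -[gamma i]invgK; apply: commuteV.
  split=> [/(congr1 tmx)|h].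
    by rewrite !tmxM tmx_gamma mulmxDr mulmxDl mulmx1 mul1mx => /addrI.
  by apply: tmx_inj; rewrite !tmxM tmx_gamma mulmxDr mulmxDl mulmx1 mul1mx h.
split=> [Dt i j ij|t_diag i].
  have /gammaC/(congr1 (fun A : 'M_n => A i j)) := Dt j.
  by rewrite mul_mx_delta mul_delta_mx_row eqxx (negPf ij).
apply/gammaC/matrixP => p q; rewrite mul_mx_delta mul_delta_mx_row.
have [->|pi] := eqVneq p i; have [->|qi] := eqVneq q i => //.
  by rewrite (t_diag i q) 1?eq_sym.
by rewrite (t_diag p i).
Qed.

Lemma ratioE t i : inD g t -> ratio a c t i = E (tmx t i i / tmx t ord_max ord_max).
Proof.
move=> /inDE t_diag; rewrite /ratio; have [->|im] := eqVneq i ord_max.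
  by rewrite divff ?tmx_diag_neq0 //; apply: tmx_inj; rewrite tmx_c tmxE scale1r.
set w := (c i ^ t^-1)%g.
have wE : tmx w = 1%:M + (tmx t i i / tmx t ord_max ord_max) *: D i ord_max.
  have E1 : tmx w *m tmx t = tmx t *m tmx (c i).
    by rewrite -!tmxM /w conjgE invgK -mulgA mulgVK.
  have : tmx w *m tmx t = (1%:M + (tmx t i i / tmx t ord_max ord_max) *: D i ord_max) *m tmx t.
    rewrite E1 tmx_c mulmxDl mulmxDr mulmx1 mul1mx; congr (_ + _).
    rewrite -scalemxAl; apply/matrixP => p q; rewrite [RHS]mxE mul_mx_delta mul_delta_mx_row.
    have [->|pi] := eqVneq p i; have [->|qm] := eqVneq q ord_max; rewrite ?mulr0n ?mulr1n ?mulr0 //.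
    - by rewrite divfK ?tmx_diag_neq0.
    - by rewrite (t_diag ord_max q) ?mulr0 1?eq_sym.
    - by rewrite (t_diag p i).
  by move/(can_inj (mulmxK (valP (val t)))).
rewrite entryE => [|p]; rewrite wE !mxE.
  by rewrite !eqxx (negPf im) mulr1 subr0 add0r.
rewrite eqxx; have [->|_] := eqVneq p i; last by rewrite mulr0 addr0.
by rewrite (negPf im) mulr0 addr0.
Qed.

Lemma unipotent_UTn x : unipotent x -> exists V : UTn F n, val V = val x.
Proof.
move=> hx; have xU : val x \in @unitri F n.
  by apply/unitriP; split; [exact: valP|exact: hx].
by exists (exist (fun A => A \in @unitri F n) (val x) xU).
Qed.

Lemma UTn_unipotent (V : UTn F n) : exists2 x : T, unipotent x & val V = val x.
Proof.
have /unitriP[V_up V_diag] := valP V.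
by exists (exist (fun A => A \in @uppertri F n) (val V) V_up).
Qed.

Lemma entry_UTn (V : UTn F n) x i j : val V = val x -> unipotent x ->
  entry a c i j x = E (uni_coef V i j).
Proof. by move=> Vx hx; rewrite entryE // /uni_coef Vx. Qed.

Lemma unipotent_frame_Tn : unipotent_frame a c g.
Proof.
have hE := coordinates_c.
split; first by move=> x y /inUE hx /inUE hy; apply/inUE/unipotentM.
split; first by move=> x t /inUE hx _; apply/inUE/unipotentJ.
split.
  move=> x /inUE hx i j; have [V Vx] := unipotent_UTn hx.
  rewrite (entry_UTn i j Vx hx); split; first by apply/inN_E; exists (uni_coef V i j).
  by move=> ji; rewrite uni_coef0 // E_0.
split.
  move=> A A_N.
  have /choice[k kA] : forall ij, exists k, A ij = E k.
    by move=> [i j]; apply/inN_E; case: (A_N i j).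
  have [i j ji|V VE] := uni_coef_onto (A := fun i j => k (i, j)).
    by apply: E_inj; rewrite -kA E_0; case: (A_N i j) => _; apply.
  have [x hx Vx] := UTn_unipotent V; exists x; split; first exact/inUE.
  by move=> i j; rewrite (entry_UTn i j Vx hx) VE kA.
split.
  move=> x y /inUE hx /inUE hy; have [V Vx] := unipotent_UTn hx; have [W Wy] := unipotent_UTn hy.
  move=> xy; apply: val_inj; rewrite -Vx -Wy; congr val.
  by apply: uni_coef_inj => i j; apply: E_inj; rewrite -(entry_UTn i j Vx hx) xy (entry_UTn i j Wy hy).
move=> x y /inUE hx /inUE hy i k z zE.
have [V Vx] := unipotent_UTn hx; have [W Wy] := unipotent_UTn hy.
have VWxy : val (V * W)%g = val (x * y)%g by rewrite !valM Vx Wy.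
rewrite (entry_UTn i k VWxy (unipotentM hx hy)) (entry_UTn i k Vx hx) (entry_UTn i k Wy hy).
rewrite uni_coefM !ED; congr (_ * _)%g; rewrite (big_morph E ED E_0).
apply: eq_bigr => j _; apply/esym/(coordM hE).
by rewrite -(entry_UTn i j Vx hx) -(entry_UTn j k Wy hy).
Qed.

Lemma ratio1_scalar t : inD g t -> (forall i, ratio a c t i = E 1) ->
  tmx t = (tmx t ord_max ord_max)%:M.
Proof.
move=> Dt t1; apply/matrixP => i j; rewrite [RHS]mxE.
have [<-|ij] := eqVneq i j; last by have /inDE -> := Dt.
have := t1 i; rewrite ratioE // => /E_inj E1.
by rewrite mulr1n -[LHS](divfK (tmx_diag_neq0 t ord_max)) E1 mul1r.
Qed.

Lemma diagonal_frame_Tn : diagonal_frame a c g.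
Proof.
have hE := coordinates_c.
have t0 (t : T) i : tmx t i i != 0 by apply: tmx_diag_neq0.
split.
  move=> t Dt i; rewrite ratioE //; split; first by apply/inN_E; eexists.
  rewrite -E_0 => /E_inj/eqP; rewrite mulf_eq0 invr_eq0.
  by rewrite (negPf (t0 _ _)) (negPf (t0 _ _)).
split.
  move=> s t Ds Dt i; rewrite !ratioE //; last exact: inDM.
  apply/(coordM hE); rewrite !tmx_diagM; congr E.
  by rewrite invfM mulrACA.
split.
  move=> A A_N; have /choice[k kA] : forall i, exists k, A i = E k.
    by move=> i; apply/inN_E; case: (A_N i).
  have k0 i : k i != 0.
    by apply/eqP => ki; have [_] := A_N i; rewrite kA ki E_0.
  have [i|t tE] := exists_diag (d := fun i => if i == ord_max then 1 else k i).
    by case: ifP; rewrite ?oner_neq0.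
  have Dt : inD g t by apply/inDE => i j ij; rewrite tE (negPf ij).
  exists t; split=> // i /eqP im; rewrite ratioE // !tE !eqxx (negPf im) /=.
  by rewrite !mulr1n divr1 kA.
split.
  move=> t Dt t1 x; apply: tmx_inj; rewrite !tmxM ratio1_scalar ?scalar_mxC //.
  by move=> i; rewrite t1 (coord1 hE).
split.
  move=> s t /inDE s_diag /inDE t_diag; apply: tmx_inj; rewrite !tmxM.
  have diagE (r : T) : (forall i j, i != j -> tmx r i j = 0) -> tmx r = diag_mx (\row_i tmx r i i).
    by move=> rE; apply/matrixP => i j; rewrite !mxE; case: eqVneq => [->|/rE].
  rewrite (diagE _ s_diag) (diagE _ t_diag) !mulmx_diag; congr diag_mx.
  by apply/rowP => i; rewrite !mxE mulrC.
split.
  move=> x; have [//|t tE] := exists_diag (d := fun i => tmx x i i).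
  exists (x * t^-1)%g, t; split; last split; last by rewrite mulgVK.
    by apply/inUE => i; rewrite tmx_diagM tmx_diagV tE eqxx mulr1n divff.
  by apply/inDE => i j ij; rewrite tE (negPf ij).
split.
  move=> x /inUE hx /inDE x_diag; apply: tmx_inj; apply/matrixP => i j.
  by rewrite tmx1 mxE; have [<-|ij] := eqVneq i j; [rewrite hx|rewrite x_diag].
move=> t x Dt /inUE hx i j z.
have hxt := unipotentJ (t^-1)%g hx.
rewrite !ratioE // !entryE // => /(coordM hE) ->; apply/(coordM hE).
have /inDE t_diag := Dt.
have : tmx (x ^ t^-1)%g i j * tmx t j j = tmx t i i * tmx x i j.
  have -> : tmx t i i * tmx x i j = tmx (t * x)%g i j.
    rewrite tmxM mxE (bigD1 i) //= big1 ?addr0 // => l li.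
    by rewrite t_diag ?mul0r 1?eq_sym.
  have <- : (x ^ t^-1 * t = t * x)%g by rewrite conjgE invgK -mulgA mulgVK.
  rewrite [RHS]mxE (bigD1 j) //= big1 ?addr0 // => l lj.
  by rewrite t_diag ?mulr0.
move=> E1; congr E; rewrite mulrBr mulrBl mulrAC -E1 mulrA; congr (_ - _).
by have [->|_] := eqVneq i j; rewrite ?mulr1 ?mul1r ?mulr0 ?mul0r.
Qed.

Lemma central_scalar z : (forall x, z * x = x * z)%g -> tmx z = (tmx z ord_max ord_max)%:M.
Proof.
move=> cz; apply: ratio1_scalar => [|i]; first exact: inD_central.
exact: (ratio_central coordinates_c diagonal_frame_Tn).
Qed.

End Frame.

Lemma exists_frame_elements : (1 < m)%N -> 2%:R != 0 :> F ->
  exists (E : F -> T) (alpha c gamma : 'I_n -> T),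
  [/\ forall k, tmx (E k) = 1%:M + k *: D ord0 ord_max,
      forall i, tmx (alpha i) = 1%:M + D ord0 i,
      forall i, tmx (c i) = 1%:M + D i ord_max
    & forall i, tmx (gamma i) = 1%:M + D i i].
Proof.
move=> m_ge2 two_neq0.
have elementary (i j : 'I_n) : (i <= j)%N -> exists x, tmx x = 1%:M + D i j.
  move=> ij; have [|x xE] := @tmx_elementary i j 1 ij; last by exists x; rewrite xE scale1r.
  rewrite mulr1 -subr_eq0 opprK; case: (i == j); first by rewrite -mulr2n.
  by rewrite add0r oner_neq0.
have /choice[E EE] k : exists x, tmx x = 1%:M + k *: D ord0 ord_max.
  apply: tmx_elementary => //.
  by rewrite -val_eqE /= ltn_eqF ?(ltnW m_ge2) // mul0r eq_sym oppr_eq0 oner_neq0.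
have /choice[alpha alphaE] i : exists x, tmx x = 1%:M + D ord0 i by apply: elementary.
have /choice[c cE] i : exists x, tmx x = 1%:M + D i ord_max.
  by apply: elementary; rewrite /= -ltnS.
have /choice[gamma gammaE] i : exists x, tmx x = 1%:M + D i i by apply: elementary.
by exists E, alpha, c, gamma.
Qed.

(** 2 is invertible, so that 1 + E_ii belongs to T_n(F). *)
Lemma has_frame_Tn : (1 < m)%N -> 2%:R != 0 :> F -> has_frame m T.
Proof.
move=> m_ge2 two_neq0.
have [E [alpha [c [gamma [EE alphaE cE gammaE]]]]] := exists_frame_elements m_ge2 two_neq0.
exists (fun i => (alpha i)^-1)%g, c, (fun i => (gamma i)^-1)%g; split.
  have -> : c ord0 = E 1 by apply: tmx_inj; rewrite cE EE scale1r.
  by apply: (conj_field_E m_ge2 EE gammaE); rewrite oner_neq0.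
split; first exact: (unipotent_frame_Tn m_ge2 EE alphaE cE gammaE).
exact: (diagonal_frame_Tn m_ge2 EE alphaE cE gammaE).
Qed.

Lemma coordinates_Tn (v : T) : (1 < m)%N -> 2%:R != 0 :> F ->
  inN v -> v <> 1%g -> exists phi : F -> T, coordinates v phi.
Proof.
move=> m_ge2 two_neq0.
have [E [alpha [c [gamma [EE alphaE cE gammaE]]]]] := exists_frame_elements m_ge2 two_neq0.
move=> /(inN_E m_ge2 EE gammaE)[k ->] k1; exists (fun b => E (b * k)).
apply: (coordinates_E m_ge2 EE gammaE); apply: contra_not_neq k1 => ->.
exact: E_0.
Qed.

Lemma group_iso_center_units : (1 < m)%N -> 2%:R != 0 :> F ->
  group_iso (center T) (units F).
Proof.
move=> m_ge2 two_neq0.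
have [E [alpha [c [gamma [EE alphaE cE gammaE]]]]] := exists_frame_elements m_ge2 two_neq0.
have /choice[f fE] (u : units F) : exists z : center T, tmx (val z) = (val u)%:M.
  have [i j ji|i|z zE] := @tmx_onto (val u)%:M.
  - by rewrite mxE -val_eqE /= gtn_eqF.
  - by rewrite mxE eqxx mulr1n; apply: valP u.
  have zC : z \in @centerg T.
    by apply/centergP => x; apply: tmx_inj; rewrite !tmxM zE scalar_mxC.
  by exists (exist (fun z => z \in @centerg T) z zC).
apply: (group_iso_inv (f := f)) => [u v|u u1|z].
- by apply/val_inj/tmx_inj; rewrite valM tmxM !fE -scalar_mxM.
- apply: val_inj; have := fE u; rewrite u1 => /(congr1 (fun A : 'M_n => A ord0 ord0)).
  by rewrite !mxE eqxx !mulr1n => <-.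
have z_scalar := central_scalar m_ge2 EE alphaE cE gammaE (elimT (centergP _) (valP z)).
pose u : units F := exist (fun x : F => x != 0) _ (tmx_diag_neq0 (val z) ord_max).
by exists u; apply/val_inj/tmx_inj; rewrite fE.
Qed.

End Triangular.

Theorem theoremA3 (n : nat) (n_ge3 : (3 <= n)%N)
  (F : fieldType) (F_infinite : infinite_set [set: F]%classic)
  (F_char : 2%N \notin [pchar F])
  (H : groupType) (H_equiv : group_equiv H (Tn F n)) :
  (exists (L : fieldType) (f : sym_cocycle (Bn L n) (center H)),
      field_equiv L F /\ group_iso H (Tn_deform f)) /\
  group_equiv (center H) (center (Tn F n)) /\
  group_iso (center (Tn F n)) (units F).
Proof.
have two_neq0 : 2%:R != 0 :> F by move: F_char; rewrite inE.
case: n n_ge3 H_equiv => [//|m] m_ge2 H_equiv.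
split; last by split; [exact: group_equiv_center|exact: group_iso_center_units].
have [a [c [g [hc [frame_uni frame_diag]]]]] : has_frame m H.
  exact: transfer_sentence (def_has_frame m) H_equiv (has_frame_Tn m_ge2 two_neq0).
have [L [psi hpsi]] := exists_coordinates hc.
have [f Hf] := group_iso_of_frame hpsi frame_uni frame_diag.
exists L, f; split=> //; apply: (field_equiv_of_coordinates H_equiv hpsi) => v Nv v1.
exact: coordinates_Tn.
Qed.
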